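(* Let $\mathcal C\subset\mathbb P^1\times\mathbb P^1$ be a smooth biquadratic curve given by the polynomial $Q(x,y)=\sum_{i,j=0}^{2}a_{ij}x^iy^j$ with complex coefficients, and let $\Gamma\subset\mathbb P^2$ be its corresponding cubic, with affine equation $y^2=4x^3-D_{\mathcal C}x+E_{\mathcal C}$. Put $$X_0=\frac{a_{11}^2-4a_{12}a_{10}-4a_{21}a_{01}+8a_{02}a_{20}+8a_{22}a_{00}}{12},\qquad Y_0=\det(a_{ij}),\quad i,j=0,1,2.$$ Then the following statements hold: (a) The QRT transformation on $\mathcal C$ is of order $n$ if and only if the translation on the cubic $\Gamma$ from the point at infinity $[0:1:0]$ to the point $[X_0:Y_0:1]$ is of order $n$. (b) The translation on the cubic $\Gamma$ from the point at infinity $[0:1:0]$ to the point $[X_0:Y_0:1]$ is of order $n$ if and only if one of the following cases holds: (i) $n=2$ and $\det(a_{ij})=0$; (ii) $n=2k+1$, $k\ge1$, and $$\det\begin{pmatrix}C_2&C_3&\dots&C_{k+1}\\ C_3&C_4&\dots&C_{k+2}\\ &&\dots&\\ C_{k+1}&C_{k+2}&\dots&C_{2k}\end{pmatrix}=0;$$ (iii) $n=2k$, $k\ge2$, and $$\det\begin{pmatrix}C_3&C_4&\dots&C_{k+1}\\ C_4&C_5&\dots&C_{k+2}\\ &&\dots&\\ C_{k+1}&C_{k+2}&\dots&C_{2k-1}\end{pmatrix}=0.$$ Here, the entries $C_k$ of the matrices are the coefficients in the following Taylor expansion about the point $[X_0:Y_0:1]$ on the curve $\Gamma$: $$\sqrt{4x^3-D_{\mathcal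 C}x+E_{\mathcal C}}=C_0+C_1(x-X_0)+C_2(x-X_0)^2+C_3(x-X_0)^3+\cdots.$$ (c) Moreover, the coefficients $C_0,C_1,\dots$ are rational in $a_{ij}$.
   Context: The biquadratic curve $\mathcal C\subset\mathbb P^1\times\mathbb P^1$ of $Q$ is the zero set of $\sum_{i,j=0}^2a_{ij}x_0^ix_1^{2-i}y_0^jy_1^{2-j}$, with affine coordinates $x=x_0/x_1$, $y=y_0/y_1$. On $\mathcal C$, the horizontal switch $h$ maps $(x,y)$ to $(x',y)$, where $x,x'$ are the two solutions of $Q(\cdot,y)=0$, and the vertical switch $v$ maps $(x,y)$ to $(x,y')$, where $y,y'$ are the two solutions of $Q(x,\cdot)=0$. Both are involutions, and the QRT transformation is $\delta=v\circ h$. Write $Q=a(x)y^2+b(x)y+c(x)$ and let $\mathcal D_{Q_y}(x)=b(x)^2-4a(x)c(x)$, a polynomial of degree at most $4$. For a quartic $a_4x^4+4a_3x^3+6a_2x^2+4a_1x+a_0$ the Eisenstein invariants are $D=a_0a_4+3a_2^2-4a_1a_3$ and $E=a_0a_3^2+a_1^2a_4-a_0a_2a_4-2a_1a_2a_3+a_2^3$. $D_{\mathcal C}$ and $E_{\mathcal C}$ denote the Eisenstein invariants of $\mathcal D_{Q_y}(x)$ (they coincide with those of the discriminant of $Q$ viewed as a quadratic polynomial in $x$). For smooth $\mathcal C$, the cubic $\Gamma$ is smooth and isomorphic to $\mathcal C$; translations on $\Gamma$ are with respect to its group structure.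
   Formalization: In (b) ''of order n'' is mended: either the n-th iterate is the identity, with Y_0≠0 assumed if n>2, or exact order n, with a case holding for n and none for 0<m<n; (ii) and (iii) require Y_0≠0. As written (b) fails: order 3 also satisfies (iii) for n=6. *)

(* Defs.v *)
From HB Require Import structures.
From mathcomp Require Import all_boot all_order all_algebra.
From mathcomp Require Import complex.
From mathcomp Require Import all_classical all_reals all_analysis.
From mathcomp Require mpoly.
Set Implicit Arguments.
Unset Strict Implicit.
Unset Printing Implicit Defensive.
Import Order.TTheory GRing.Theory Num.Theory.
Import numFieldNormedType.Exports.
Local Open Scope classical_set_scope.
Local Open Scope ring_scope.

Section Orders.
Context {T : Type}.

(* The n-th iterate of f is the identity on S. *)
Definition n_periodic (S : set T) (f : T -> T) (n : nat) : Prop :=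
  forall p, S p -> iter n f p = p.

Definition has_order (S : set T) (f : T -> T) (n : nat) : Prop :=
  [/\ (0 < n)%N, n_periodic S f n
    & forall m, (0 < m < n)%N -> ~ n_periodic S f m].

End Orders.

Section ProjectiveLine.
Context {K : fieldType}.

(* P^1(K) = K + {oo}: [Some x] is [x : 1] and [None] is [1 : 0]. *)
Definition P1 : Type := option K.

Definition hom0 (p : P1) : K := if p is Some x then x else 1.
Definition hom1 (p : P1) : K := if p is Some _ then 1 else 0.

(* The binary quadratic form q_0 u1^2 + q_1 u0 u1 + q_2 u0^2 is nonzero and
   its zeros on P^1, counted with multiplicity, are p and p'. *)
Definition two_solutions (q : nat -> K) (p p' : P1) : Prop :=
  exists2 c : K, c != 0 & forall u0 u1 : K,
    \sum_(i < 3) q i * u0 ^+ i * u1 ^+ (2 - i)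
    = c * (u0 * hom1 p - u1 * hom0 p) * (u0 * hom1 p' - u1 * hom0 p').

(* The solution other than p (equal to p when p is a double solution); the
   value is p by default when q vanishes identically or p is not a zero. *)
Definition other_solution (q : nat -> K) (p : P1) : P1 :=
  xget p [set p' | two_solutions q p p'].

End ProjectiveLine.
Arguments P1 K : clear implicits.

Section Biquadratic.
Context {K : fieldType}.
Implicit Types A : 'M[K]_3.

Definition coef A (i j : nat) : K := A (inord i) (inord j).

Definition biform A (x0 x1 y0 y1 : K) : K :=
  \sum_(i < 3) \sum_(j < 3)
    coef A i j * x0 ^+ i * x1 ^+ (2 - i) * y0 ^+ j * y1 ^+ (2 - j).

Definition biform_dx0 A (x0 x1 y0 y1 : K) : K :=
  \sum_(i < 3) \sum_(j < 3) coef A i j *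
    (x0 ^+ i.-1 *+ i) * x1 ^+ (2 - i) * y0 ^+ j * y1 ^+ (2 - j).

Definition biform_dx1 A (x0 x1 y0 y1 : K) : K :=
  \sum_(i < 3) \sum_(j < 3) coef A i j *
    x0 ^+ i * (x1 ^+ (2 - i).-1 *+ (2 - i)) * y0 ^+ j * y1 ^+ (2 - j).

Definition biform_dy0 A (x0 x1 y0 y1 : K) : K :=
  \sum_(i < 3) \sum_(j < 3) coef A i j *
    x0 ^+ i * x1 ^+ (2 - i) * (y0 ^+ j.-1 *+ j) * y1 ^+ (2 - j).

Definition biform_dy1 A (x0 x1 y0 y1 : K) : K :=
  \sum_(i < 3) \sum_(j < 3) coef A i j *
    x0 ^+ i * x1 ^+ (2 - i) * y0 ^+ j * (y1 ^+ (2 - j).-1 *+ (2 - j)).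

Definition biquadratic_curve A : set (P1 K * P1 K) :=
  [set p | biform A (hom0 p.1) (hom1 p.1) (hom0 p.2) (hom1 p.2) = 0].

(* Jacobian criterion in bihomogeneous coordinates. *)
Definition smooth_biquadratic A : Prop :=
  forall p, biquadratic_curve A p ->
    ~ [/\ biform_dx0 A (hom0 p.1) (hom1 p.1) (hom0 p.2) (hom1 p.2) = 0,
          biform_dx1 A (hom0 p.1) (hom1 p.1) (hom0 p.2) (hom1 p.2) = 0,
          biform_dy0 A (hom0 p.1) (hom1 p.1) (hom0 p.2) (hom1 p.2) = 0
        & biform_dy1 A (hom0 p.1) (hom1 p.1) (hom0 p.2) (hom1 p.2) = 0].

(* Coefficients of Q(., y) and of Q(x, .) as binary quadratic forms. *)
Definition form_at_y A (y : P1 K) (i : nat) : K :=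
  \sum_(j < 3) coef A i j * hom0 y ^+ j * hom1 y ^+ (2 - j).

Definition form_at_x A (x : P1 K) (j : nat) : K :=
  \sum_(i < 3) coef A i j * hom0 x ^+ i * hom1 x ^+ (2 - i).

Definition horizontal_switch A (p : P1 K * P1 K) : P1 K * P1 K :=
  (other_solution (form_at_y A p.2) p.1, p.2).

Definition vertical_switch A (p : P1 K * P1 K) : P1 K * P1 K :=
  (p.1, other_solution (form_at_x A p.1) p.2).

Definition QRT A : P1 K * P1 K -> P1 K * P1 K :=
  vertical_switch A \o horizontal_switch A.

(* Q = Qy_coef 2 * y^2 + Qy_coef 1 * y + Qy_coef 0, with coefficients
   polynomials in x. *)
Definition Qy_coef A (j : nat) : {poly K} := \poly_(i < 3) coef A i j.

Definition disc_Qy A : {poly K} :=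
  Qy_coef A 1 ^+ 2 - 4%:R *: (Qy_coef A 2 * Qy_coef A 0).

(* The i-th coefficient of a quartic without its binomial factor 'C(4, i). *)
Definition quartic_coef (p : {poly K}) (i : nat) : K := p`_i / 'C(4, i)%:R.

Definition eisenstein_D (p : {poly K}) : K :=
  let a := quartic_coef p in
  a 0%N * a 4%N + 3%:R * a 2%N ^+ 2 - 4%:R * a 1%N * a 3%N.

Definition eisenstein_E (p : {poly K}) : K :=
  let a := quartic_coef p in
  a 0%N * a 3%N ^+ 2 + a 1%N ^+ 2 * a 4%N - a 0%N * a 2%N * a 4%N
  - 2%:R * a 1%N * a 2%N * a 3%N + a 2%N ^+ 3.

Definition D_curve A : K := eisenstein_D (disc_Qy A).
Definition E_curve A : K := eisenstein_E (disc_Qy A).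

Definition X0 A : K :=
  (coef A 1 1 ^+ 2 - 4%:R * coef A 1 2 * coef A 1 0
   - 4%:R * coef A 2 1 * coef A 0 1 + 8%:R * coef A 0 2 * coef A 2 0
   + 8%:R * coef A 2 2 * coef A 0 0) / 12%:R.

Definition Y0 A : K := \det A.

End Biquadratic.

Section Cubic.
Context {K : fieldType}.
Variables D E : K.

Definition cubic_rhs (x : K) : K := 4%:R * x ^+ 3 - D * x + E.

(* [Some (x, y)] is [x : y : 1]; [None] is [0 : 1 : 0], the only point at
   infinity of the cubic. *)
Definition cubic : set (option (K * K)) :=
  [set P | if P is Some (x, y) then y ^+ 2 = cubic_rhs x else True].

(* Chord-tangent addition with neutral element [0 : 1 : 0]: the line of slope l
   through P and Q (tangent if P = Q) meets the cubic at a third point of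
   abscissa l^2 / 4 - x1 - x2, which is then reflected by (x, y) -> (x, - y). *)
Definition cubic_add (P Q : option (K * K)) : option (K * K) :=
  match P, Q with
  | None, _ => Q
  | _, None => P
  | Some (x1, y1), Some (x2, y2) =>
      if (x1 == x2) && (y1 == - y2) then None
      else
        let l := if x1 == x2 then (12%:R * x1 ^+ 2 - D) / (2%:R * y1)
                 else (y2 - y1) / (x2 - x1) in
        let x3 := l ^+ 2 / 4%:R - x1 - x2 in
        Some (x3, - (y1 + l * (x3 - x1)))
  end.

End Cubic.

Section Gamma.
Context {K : fieldType}.
Implicit Types A : 'M[K]_3.

Definition Gamma_curve A : set (option (K * K)) :=
  cubic (D_curve A) (E_curve A).

(* The translation of Gamma that takes [0 : 1 : 0] to [X0 : Y0 : 1]. *)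
Definition translation A (P : option (K * K)) : option (K * K) :=
  cubic_add (D_curve A) P (Some (X0 A, Y0 A)).

End Gamma.

Definition taylor {K : numFieldType} (f : K -> K) (x : K) (k : nat) : K :=
  derive1n k f x / (k`!)%:R.

Section Taylor.
Context {R : realType}.
Implicit Types A : 'M[R[i]]_3.

(* The branch near X0 of the square root of 4 x^3 - D x + E with value Y0 at X0
   (sqrtc is the principal branch, and 4 X0^3 - D X0 + E = Y0^2).  It is
   holomorphic at X0 when Y0 != 0; when Y0 = 0 there is no holomorphic branch
   and this function is identically 0. *)
Definition sqrt_branch A (x : R[i]) : R[i] :=
  Y0 A * sqrtc (cubic_rhs (D_curve A) (E_curve A) x / Y0 A ^+ 2).

Definition taylor_coef A (k : nat) : R[i] :=
  taylor (sqrt_branch A) (X0 A) k.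

Definition hankel (C : nat -> R[i]) (s m : nat) : 'M[R[i]]_m :=
  \matrix_(i < m, j < m) C (s + i + j)%N.

(* Y0 != 0 is what makes the Taylor expansion meaningful. *)
Definition case_i A (n : nat) : Prop := n = 2%N /\ \det A = 0.

Definition case_ii A (n : nat) : Prop :=
  exists k : nat, [/\ (1 <= k)%N, n = (2 * k + 1)%N, Y0 A != 0
                    & \det (hankel (taylor_coef A) 2 k) = 0].

Definition case_iii A (n : nat) : Prop :=
  exists k : nat, [/\ (2 <= k)%N, n = (2 * k)%N, Y0 A != 0
                    & \det (hankel (taylor_coef A) 3 k.-1) = 0].

Definition one_of_cases A (n : nat) : Prop :=
  [\/ case_i A n, case_ii A n | case_iii A n].

(* Value at the nine entries of A of a polynomial with rational coefficients. *)
Definition eval_entries (p : mpoly.mpoly (3 * 3) rat) A : R[i] :=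
  mpoly.mmap (fun c : rat => ratr c) (fun k => mxvec A 0 k) p.

End Taylor.

(* Main.v *)
Require Import Defs.
From HB Require Import structures.
From mathcomp Require Import all_boot all_order all_algebra.
From mathcomp Require Import complex.
From mathcomp Require Import all_classical all_reals all_analysis.
From mathcomp Require mpoly.
From mathcomp Require Import zify ring.
Import Order.TTheory GRing.Theory Num.Theory.
Import numFieldNormedType.Exports.

(** Part (a). Consider a biquadratic form Q = a(x) y^2 + b(x) y + c(x) and put
    w = 2 a(x) y + b(x), so that w^2 is the discriminant of Q in y. At a root of
    the discriminant the two solutions y coincide; moving such a point to
    (oo, oo) by unimodular changes of both coordinates makes a(x) and b(x) affine
    and the discriminant a cubic polynomial in x, and X = X0 - k x, Y = k w, for a
    suitable constant k and origin of x, maps the curve injectively to Gamma. The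
    vertical switch changes the sign of w, hence becomes the opposite on Gamma.
    On a horizontal line w is an affine function of x whose value at x = 0 does
    not depend on the line, so the images of a point and of its horizontal switch
    are collinear with a fixed point, which turns out to be [X0 : Y0 : 1]; the QRT
    map therefore becomes the translation by [X0 : Y0 : 1]. Since X0, Y0, D and E are invariants of unimodular changes of
    both variables, this holds for every smooth curve
    ([smooth_translation_model]).

    The group law. The translation by P0 has the n-th iterate equal to the
    identity as soon as this iterate fixes the point at infinity. To see it, send
    a point P to the class of its maximal ideal in the coordinate ring
    K[x] + K[x] y of the affine cubic. The chord-tangent construction makes this
    multiplicative ([point_class_add]), because the ideals of three collinear
    points multiply to the principal ideal of their line; and it is injective
    ([point_class_inj]), because no function has a norm of degree 1. So the
    n-th iterate multiplies each class by the n-th power of the class of P0, and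
    it is the identity if and only if the n-th power of the ideal of P0 is
    principal.

    Part (b). If Y0 <> 0, then x is a local parameter at P0 = (X0, Y0), where
    y = S(x) with S the Taylor series of the square root. A generator of the n-th
    power of the ideal of P0 is a function A(x) + B(x) y, with a pole of order at
    most n at infinity, such that A + B S vanishes to order n at X0
    ([expI_principal]). The bound on the pole bounds the degrees of A and B;
    eliminating A leaves as many linear equations as B has coefficients, and their
    matrix is the Hankel matrix of the statement ([pade_hankel]).

    Part (c). By induction on k, the k-th derivative of a square root s of a
    polynomial F is a polynomial in x divided by s^(2k+1). At X0 the denominator
    is Y0^(2k+1), and the numerator is a polynomial with rational coefficients in
    X0, D and E, hence in the entries. The Taylor coefficients C_k have F as their
    convolution square, which is all that Part (b) uses of the analytic
    definition. *)

Set Implicit Arguments.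
Unset Strict Implicit.
Unset Printing Implicit Defensive.
Local Open Scope classical_set_scope.
Local Open Scope ring_scope.

(** * The coordinate ring of a cubic *)

(** The pair (A, B) stands for the function A + B y on the curve y^2 = f. *)
Definition crd (K : fieldType) (f : {poly K}) : Type := ({poly K} * {poly K})%type.

Section CoordinateRing.
Context {K : fieldType} (f : {poly K}).
HB.instance Definition _ := GRing.Zmodule.on (crd f).

Definition crd_mul (g h : crd f) : crd f :=
  (g.1 * h.1 + f * g.2 * h.2, g.1 * h.2 + g.2 * h.1).
Definition crd_one : crd f := (1, 0).

Fact crd_mulA : associative crd_mul.
Proof. by move=> [a b] [c d] [e g]; congr pair; rewrite /=; ring. Qed.
Fact crd_mulC : commutative crd_mul.
Proof. by move=> [a b] [c d]; congr pair; rewrite /=; ring. Qed.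
Fact crd_mul1 : left_id crd_one crd_mul.
Proof. by move=> [a b]; congr pair; rewrite /=; ring. Qed.
Fact crd_mulD : left_distributive crd_mul +%R.
Proof. by move=> [a b] [c d] [e g]; congr pair; rewrite /=; ring. Qed.
Fact crd_one_neq0 : crd_one != 0.
Proof. by apply/eqP => -[] /eqP; rewrite oner_eq0. Qed.
HB.instance Definition _ := GRing.Zmodule_isComNzRing.Build (crd f)
  crd_mulA crd_mulC crd_mul1 crd_mulD crd_one_neq0.

Definition ofpoly (p : {poly K}) : crd f := (p, 0).
Definition crd_conj (g : crd f) : crd f := (g.1, - g.2).
Definition nrm (g : crd f) : {poly K} := g.1 ^+ 2 - f * g.2 ^+ 2.

Lemma crdM (g h : crd f) :
  g * h = (g.1 * h.1 + f * g.2 * h.2, g.1 * h.2 + g.2 * h.1).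
Proof. by []. Qed.

Lemma crdD (g h : crd f) : g + h = (g.1 + h.1, g.2 + h.2).
Proof. by []. Qed.

Lemma ofpolyM p q : ofpoly (p * q) = ofpoly p * ofpoly q.
Proof. by rewrite crdM; congr pair; rewrite /=; ring. Qed.

Lemma ofpolyX p n : ofpoly (p ^+ n) = ofpoly p ^+ n.
Proof. by elim: n => [|n IH]; rewrite ?expr0 // !exprS ofpolyM IH. Qed.

Lemma conjK : involutive crd_conj.
Proof. by case=> a b; rewrite /crd_conj /= opprK. Qed.

Lemma conjM (g h : crd f) : crd_conj (g * h) = crd_conj g * crd_conj h.
Proof. by rewrite !crdM /crd_conj; congr pair; rewrite /=; ring. Qed.

Lemma conjD (g h : crd f) : crd_conj (g + h) = crd_conj g + crd_conj h.
Proof. by rewrite !crdD /crd_conj; congr pair; rewrite /=; ring. Qed.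

Lemma conj0 : crd_conj 0 = 0.
Proof. by rewrite /crd_conj /= oppr0. Qed.

Lemma mul_conj (g : crd f) : g * crd_conj g = ofpoly (nrm g).
Proof. by rewrite crdM /crd_conj /ofpoly /nrm; congr pair; rewrite /=; ring. Qed.

Lemma nrmM (g h : crd f) : nrm (g * h) = nrm g * nrm h.
Proof. by rewrite crdM /nrm /=; ring. Qed.

Lemma nrm_ofpoly p : nrm (ofpoly p) = p ^+ 2.
Proof. by rewrite /nrm /=; ring. Qed.

(** As f has odd degree, the leading terms of A^2 and f B^2 have degrees of
    different parity and cannot cancel. *)
Lemma size_nrm (g : crd f) : size f = 4%N ->
  size (nrm g) = maxn ((size g.1).*2.-1) (if g.2 == 0 then 0 else (size g.2).*2.+2).
Proof.
move=> sf; case: g => A B; rewrite /nrm /=.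
have fN0 : f != 0 by rewrite -size_poly_eq0 sf.
have sA : size (A ^+ 2) = (size A).*2.-1.
  have [->|AN0] := eqVneq A 0; first by rewrite expr0n size_poly0.
  by rewrite expr2 size_mul // addnn.
case: eqVneq => [->|BN0]; first by rewrite expr0n mulr0 subr0 sA maxn0.
have sB : size (- (f * B ^+ 2)) = (size B).*2.+2.
  rewrite size_polyN expr2 !size_mul ?mulf_neq0 // sf addnn.
  by case: (size B) (size_poly_eq0 B) => [|m]; rewrite ?(negPf BN0).
have [->|AN0] := eqVneq A 0; first by rewrite expr0n add0r sB size_poly0 max0n.
have [lt|lt|/(congr1 odd)] := ltngtP (size A).*2.-1 (size B).*2.+2.
- by rewrite addrC size_polyDl ?sA ?sB //.
- by rewrite size_polyDl ?sA ?sB //.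
rewrite /= odd_double /=.
by case: (size A) (size_poly_eq0 A) => [|m]; rewrite ?(negPf AN0) //= odd_double.
Qed.

(** Hence the coordinate ring is an integral domain. *)
Lemma nrm_neq0 (g : crd f) : size f = 4%N -> g != 0 -> nrm g != 0.
Proof.
move=> sf gN0; rewrite -size_poly_gt0 size_nrm // leq_max.
case: eqVneq => [g20|]; last by rewrite orbT.
have g1N0 : g.1 != 0.
  by apply: contraNneq gN0 => g10; case: g g10 g20 => a b /= -> ->.
by case: (size g.1) (size_poly_eq0 g.1) => [|m]; rewrite ?(negPf g1N0).
Qed.

Lemma crd_cancel (g h k : crd f) : size f = 4%N -> g != 0 -> g * h = g * k -> h = k.
Proof.
move=> sf gN0 /eqP; rewrite -subr_eq0 -mulrBr => /eqP gh.
apply/eqP; rewrite -subr_eq0; apply/negP => /negP hkN0.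
have : nrm (g * (h - k)) == 0 by rewrite gh /nrm /= expr0n mulr0 subr0.
by rewrite nrmM mulf_eq0 (negPf (nrm_neq0 sf gN0)) (negPf (nrm_neq0 sf hkN0)).
Qed.

End CoordinateRing.

(** * Ideals and their classes *)

Section Ideals.
Context {R : comNzRingType}.
Implicit Types I J L : set R.

Definition ideal I :=
  [/\ I 0, forall a b, I a -> I b -> I (a + b) & forall r a, I a -> I (r * a)].

Inductive mulI I J : set R :=
| mulI0 : mulI I J 0
| mulID a b c : I a -> J b -> mulI I J c -> mulI I J (a * b + c).

Definition princ (g : R) : set R := [set g * k | k in [set: R]].

Fixpoint expI I n : set R := if n is m.+1 then mulI I (expI I m) else [set: R].

Lemma mulIS I J L : L 0 -> (forall a b, L a -> L b -> L (a + b)) ->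
  (forall a b, I a -> J b -> L (a * b)) -> mulI I J `<=` L.
Proof. by move=> L0 LD LM x; elim=> // a b c Ia Jb _ Lc; apply/LD/Lc/LM. Qed.

Lemma mulI_mem I J a b : I a -> J b -> mulI I J (a * b).
Proof. by move=> Ia Jb; rewrite -[a * b]addr0; apply: mulID => //; left. Qed.

Lemma mulI_add I J a b : mulI I J a -> mulI I J b -> mulI I J (a + b).
Proof. by move=> Ia Ib; elim: Ia => [|x y z *]; rewrite ?add0r -?addrA //; right. Qed.

Lemma mulIC I J : mulI I J = mulI J I.
Proof.
have sub I' J' : mulI I' J' `<=` mulI J' I'.
  apply: mulIS => [|a b|a b Ia Jb]; [by left | exact: mulI_add |].
  by rewrite mulrC; exact: mulI_mem.
by apply/seteqP; split; exact: sub.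
Qed.

Lemma mulIA I J L : mulI I (mulI J L) = mulI (mulI I J) L.
Proof.
apply/seteqP; split; apply: mulIS; do ?[by left | exact: mulI_add].
- move=> a b Ia; elim=> [|x y z Jx Ly _ IH]; first by rewrite mulr0; left.
  by rewrite mulrDr mulrA; apply/mulI_add/IH/mulI_mem/Ly/mulI_mem.
- move=> b c + Lc; elim=> [|x y z Jx Ly _ IH]; first by rewrite mul0r; left.
  by rewrite mulrDl -mulrA; apply/mulI_add/IH/mulI_mem/mulI_mem.
Qed.

Lemma mulICA I J L : mulI I (mulI J L) = mulI J (mulI I L).
Proof. by rewrite !mulIA (mulIC I). Qed.

Lemma mulIAC I J L : mulI (mulI I J) L = mulI (mulI I L) J.
Proof. by rewrite -!mulIA (mulIC J). Qed.

Lemma mulIACA I J L M : mulI (mulI I J) (mulI L M) = mulI (mulI I L) (mulI J M).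
Proof. by rewrite !mulIA (mulIAC I J). Qed.

Lemma ideal_princ g : ideal (princ g).
Proof.
split=> [|_ _ [h _ <-] [k _ <-]|r _ [h _ <-]]; first by exists 0; rewrite ?mulr0.
  by exists (h + k); rewrite ?mulrDr.
by exists (r * h); rewrite // mulrCA.
Qed.

Lemma ideal_mulI I J : ideal J -> ideal (mulI I J).
Proof.
move=> [J0 JD JM]; split=> [||r a]; [by left | exact: mulI_add |].
elim=> [|x y z Ix Jy _ IH]; first by rewrite mulr0; left.
by rewrite mulrDr mulrCA; apply/mulI_add/IH/mulI_mem/JM.
Qed.

Lemma ideal_setT : ideal [set: R]. Proof. by []. Qed.

Lemma ideal_expI I n : ideal (expI I n).
Proof. by elim: n => [|n IH]; [exact: ideal_setT | exact: ideal_mulI]. Qed.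

Lemma mul1I I : ideal I -> mulI [set: R] I = I.
Proof.
move=> [I0 ID IM]; apply/seteqP; split; first by apply: mulIS => // a b _; exact: IM.
by move=> x Ix; rewrite -[x]mul1r; apply: mulI_mem.
Qed.

Lemma mulI1 I : ideal I -> mulI I [set: R] = I.
Proof. by rewrite mulIC; exact: mul1I. Qed.

Lemma princ1 : princ 1 = [set: R].
Proof. by apply/seteqP; split=> // x _; exists x; rewrite ?mul1r. Qed.

Lemma princ_mem g : princ g g.
Proof. by exists 1; rewrite ?mulr1. Qed.

Lemma mul_princ g I : ideal I -> mulI (princ g) I = [set g * k | k in I].
Proof.
move=> [I0 ID IM]; apply/seteqP; split=> [|_ [k Ik <-]]; last first.
  exact/mulI_mem/Ik/princ_mem.
apply: mulIS => [|_ _ [h Ih <-] [k Ik <-]|_ b [k _ <-] Ib].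
- by exists 0; rewrite ?mulr0.
- by exists (h + k); rewrite ?mulrDr //; exact: ID.
- by exists (k * b); rewrite ?mulrA //; exact: IM.
Qed.

Lemma princM g h : mulI (princ g) (princ h) = princ (g * h).
Proof.
rewrite mul_princ; last exact: ideal_princ.
apply/seteqP; split=> [_ [_ [k _ <-] <-]|_ [k _ <-]].
  by exists k; rewrite ?mulrA.
by exists (h * k); [exists k | rewrite mulrA].
Qed.

Definition regular (g : R) := forall h k, g * h = g * k -> h = k.

Lemma regularM g h : regular g -> regular h -> regular (g * h).
Proof. by move=> rg rh x y; rewrite -!mulrA => /rg /rh. Qed.

Lemma regular1 : regular 1.
Proof. by move=> h k; rewrite !mul1r. Qed.

(** Equality of classes: I and J differ by a factor in the field of fractions. *)
Definition eqcl I J := exists a b,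
  [/\ regular a, regular b & mulI (princ a) I = mulI (princ b) J].

Lemma eqcl_refl I : eqcl I I.
Proof. by exists 1, 1; split=> //; exact: regular1. Qed.

Lemma eqcl_sym I J : eqcl I J -> eqcl J I.
Proof. by move=> [a [b [ra rb e]]]; exists b, a. Qed.

Lemma eqcl_trans I J L : eqcl I J -> eqcl J L -> eqcl I L.
Proof.
move=> [a [b [ra rb eab]]] [c [d [rc rd ecd]]].
exists (c * a), (b * d); split; do ?exact: regularM.
by rewrite -!princM -!mulIA eab -ecd mulICA.
Qed.

Lemma eqclM I I' J J' : eqcl I I' -> eqcl J J' -> eqcl (mulI I J) (mulI I' J').
Proof.
move=> [a [b [ra rb eab]]] [c [d [rc rd ecd]]].
exists (a * c), (b * d); split; do ?exact: regularM.
by rewrite -!princM mulIACA eab ecd mulIACA.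
Qed.

Lemma eqcl_princ g : regular g -> eqcl (princ g) [set: R].
Proof.
move=> rg; exists 1, g; split=> //; first exact: regular1.
by rewrite princ1 mul1I ?mulI1 //; exact: ideal_princ.
Qed.

Lemma eqcl1P I : ideal I -> eqcl I [set: R] -> exists g, I = princ g.
Proof.
move=> idI [a [b [ra rb]]]; rewrite mul_princ // mulI1; last exact: ideal_princ.
move=> e; have [m Im am] : [set a * k | k in I] b by rewrite e; exact: princ_mem.
exists m; apply/seteqP; split=> [i Ii|_ [k _ <-]].
- have [k _] : princ b (a * i) by rewrite -e; exists i.
  by rewrite -am -mulrA => /ra <-; exists k.
- by case: idI => _ _ IM; rewrite mulrC; exact: IM.
Qed.

End Ideals.

Section NormCriterion.
Context {K : fieldType} (f : {poly K}).
Implicit Types (g : crd f) (I J : set (crd f)).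

Definition conjI I : set (crd f) := [set g | I (crd_conj g)].

Lemma conjI_mul I J : conjI (mulI I J) = mulI (conjI I) (conjI J).
Proof.
apply/seteqP; split=> [x /=|].
  rewrite /conjI /= -{2}[x]conjK; elim: (crd_conj x) / => [|a b c Ia Jb _ IH].
    by rewrite conj0; left.
  by rewrite conjD conjM; right; rewrite /= ?conjK.
rewrite /conjI; apply: mulIS => [|a b|a b] /=.
- by rewrite conj0; left.
- by rewrite conjD; exact: mulI_add.
- by rewrite conjM; exact: mulI_mem.
Qed.

Lemma conjI_setT : conjI [set: crd f] = [set: crd f]. Proof. by []. Qed.

Lemma mulI_conj_exp I n :
  mulI (expI I n) (conjI (expI I n)) = expI (mulI I (conjI I)) n.
Proof.
elim: n => [|n IH] /=; first by rewrite conjI_setT mul1I.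
by rewrite conjI_mul mulIACA IH.
Qed.

Lemma expI_princ g n : expI (princ g) n = princ (g ^+ n).
Proof. by elim: n => [|n IH] /=; rewrite ?expr0 ?princ1 // IH princM exprS. Qed.

(** An ideal contained in (g) is g W for an ideal W; if in addition it has
    the norm of (g), then W has norm 1, so that W = 1. *)
Lemma norm_criterion I g : ideal I -> regular (g * crd_conj g) -> I `<=` princ g ->
  mulI I (conjI I) = princ (g * crd_conj g) -> I = princ g.
Proof.
move=> [I0 ID IM] rg Ig e; apply/seteqP; split=> // _ [k _ <-].
rewrite mulrC; apply: (IM).
have [w Iw gw] : exists2 w, I (g * w) & g * crd_conj g = g * crd_conj g * w.
  suff D x : mulI I (conjI I) x -> exists2 w, I (g * w) & x = g * crd_conj g * w.
    by apply: D; rewrite e; exact: princ_mem.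
  elim=> [|a b c Ia Ib _ [w Iw ->]].
    by exists 0; rewrite mulr0.
  have [a' _ aE] := Ig _ Ia; have [b' _ bE] := Ig _ Ib.
  exists (a' * crd_conj b' + w).
    by rewrite mulrDr; apply: ID => //; rewrite mulrA aE mulrC; apply: IM.
  rewrite -aE -[b]conjK -bE conjM; ring.
by have := Iw; rewrite -(rg 1 w) ?mulr1.
Qed.

End NormCriterion.

(** * The ideal class of a point of the cubic *)

Section ClassMap.
Context {K : numFieldType} (D E : K).

Definition cubic_poly : {poly K} := 4%:R%:P * 'X^3 - D%:P * 'X + E%:P.
Local Notation F := cubic_poly.
Local Notation crdF := (crd F).

Lemma cubic_polyE x : F.[x] = cubic_rhs D E x.
Proof. by rewrite /F /cubic_rhs !hornerE. Qed.

Lemma size_cubic_poly : size F = 4%N.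
Proof.
rewrite /F -addrA size_polyDl.
  by rewrite size_Cmul ?size_polyXn // pnatr_eq0.
rewrite size_Cmul ?pnatr_eq0 // size_polyXn.
apply: leq_ltn_trans (size_polyD _ _) _; rewrite gtn_max size_polyN mul_polyC.
rewrite (leq_ltn_trans (size_scale_leq _ _)) ?size_polyX //.
exact: leq_ltn_trans (size_polyC_leq1 _) _.
Qed.

(** At a singular point y = 0, so that only the derivative in x matters. *)
Definition nonsingular := forall x, cubic_rhs D E x = 0 -> 12%:R * x ^+ 2 - D != 0.

(** The functions x - a and y - L(x), and the maximal ideal of a point. *)
Definition xsub (a : K) : crdF := ofpoly F ('X - a%:P).
Definition ysub (L : {poly K}) : crdF := (- L, 1).

Definition point_ideal (a b : K) : set crdF :=
  [set g | exists u v, g = u * xsub a + v * ysub b%:P].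

Lemma regular_crd (g : crdF) : g != 0 -> regular g.
Proof. by move=> gN0 h k; apply: crd_cancel; rewrite ?size_cubic_poly. Qed.

Lemma xsub_neq0 a : xsub a != 0.
Proof.
by apply/eqP => -[] /eqP; rewrite polyXsubC_eq0.
Qed.

Lemma ysub_neq0 L : ysub L != 0.
Proof. by apply/eqP => -[_] /eqP; rewrite oner_eq0. Qed.

(** Any curve y = L(x) through the point can replace the line y = b: this is
    used with the chord through two points and with the branch of the cubic. *)
Lemma point_idealP a b L g : L.[a] = b ->
  point_ideal a b g <-> exists u v, g = u * xsub a + v * ysub L.
Proof.
move=> Lab; have /factor_theorem[q qE] : root (L - b%:P) a.
  by rewrite rootE !hornerE Lab subrr.
have eL : ysub L = ysub b%:P - ofpoly F q * xsub a.
  rewrite /ysub /xsub -ofpolyM -qE /ofpoly !crdD /=; congr pair; ring.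
split=> -[u [v ->]].
  by exists (u + v * ofpoly F q), v; rewrite eL; ring.
by exists (u - v * ofpoly F q), v; rewrite eL; ring.
Qed.

Lemma ideal_point a b : ideal (point_ideal a b).
Proof.
split=> [|g h [u [v ->]] [u' [v' ->]]|r g [u [v ->]]].
- by exists 0, 0; ring.
- by exists (u + u'), (v + v'); ring.
- by exists (r * u), (r * v); ring.
Qed.

Lemma conj_point a b : conjI (point_ideal a b) = point_ideal a (- b).
Proof.
have ex : crd_conj (xsub a) = xsub a by rewrite /crd_conj /xsub /ofpoly /= oppr0.
have ey c : crd_conj (ysub c%:P) = - ysub (- c)%:P.
  by rewrite /crd_conj /ysub [- _ in RHS]surjective_pairing /= polyCN opprK.
apply/seteqP; split=> g; rewrite /conjI /= => -[u [v gE]].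
  exists (crd_conj u), (- crd_conj v).
  by rewrite -[g]conjK gE conjD !conjM ex ey; ring.
exists (crd_conj u), (- crd_conj v).
by rewrite gE conjD !conjM ex ey opprK; ring.
Qed.

Lemma xsub_point a b : point_ideal a b (xsub a).
Proof. by exists 1, 0; ring. Qed.

Lemma ysub_point a b : point_ideal a b (ysub b%:P).
Proof. by exists 0, 1; ring. Qed.

Lemma ideal_unscale (I : set crdF) c g : ideal I -> c != 0 ->
  I (ofpoly F c%:P * g) -> I g.
Proof.
move=> [_ _ IM] cN0 /(IM (ofpoly F c^-1%:P)).
by rewrite mulrA -ofpolyM -polyCM mulVf // mul1r.
Qed.

Lemma princ_scale c (g : crdF) : c != 0 -> princ (ofpoly F c%:P * g) = princ g.
Proof.
move=> cN0; apply/seteqP; split=> _ [k _ <-].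
  by exists (ofpoly F c%:P * k) => //; ring.
exists (ofpoly F c^-1%:P * k) => //.
by rewrite mulrACA mulrA -ofpolyM -polyCM mulfV // mul1r.
Qed.

(** The product contains (x - a) (y + b) - (x - a) (y - b) = 2 b (x - a), and
    it contains F'(a) (x - a) modulo (x - a)^2; by nonsingularity b and F'(a)
    do not both vanish. *)
Lemma mul_point_opp a b : nonsingular -> cubic D E (Some (a, b)) ->
  mulI (point_ideal a b) (point_ideal a (- b)) = princ (xsub a).
Proof.
move=> ns /= ab; set q : {poly K} := 4%:R%:P * ('X^2 + a%:P * 'X + a%:P ^+ 2) - D%:P.
have yy : ysub b%:P * ysub (- b)%:P = ofpoly F q * xsub a.
  rewrite /ysub /xsub -ofpolyM /ofpoly crdM; congr pair => /=; last first.
    rewrite polyCN; ring.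
  have -> : - b%:P * - (- b)%:P = - (b ^+ 2)%:P :> {poly K} by ring.
  by rewrite ab /q /F /cubic_rhs; ring.
apply/seteqP; split.
  apply: mulIS => [|_ _ [h _ <-] [k _ <-]|_ _ [u [v ->]] [u' [v' ->]]].
  - by exists 0; rewrite ?mulr0.
  - by exists (h + k); rewrite ?mulrDr.
  - exists (u * u' * xsub a + u * v' * ysub (- b)%:P + v * u' * ysub b%:P
            + v * v' * ofpoly F q) => //.
    have -> : (u * xsub a + v * ysub b%:P) * (u' * xsub a + v' * ysub (- b)%:P)
      = xsub a * (u * u' * xsub a + u * v' * ysub (- b)%:P + v * u' * ysub b%:P)
        + v * v' * (ysub b%:P * ysub (- b)%:P) by ring.
    by rewrite yy; ring.
set I := mulI _ _; have idI : ideal I by exact/ideal_mulI/ideal_point.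
have [I0 ID IM] := idI.
suff Ix : I (xsub a) by move=> _ [k _ <-]; rewrite mulrC; exact: IM.
have [b0|bN0] := eqVneq b 0; last first.
  apply: (@ideal_unscale I (2%:R * b)) => //; first by rewrite mulf_neq0 ?pnatr_eq0.
  have -> : ofpoly F (2%:R * b)%:P = ysub (- b)%:P - ysub b%:P.
    by rewrite /ysub /ofpoly crdD; congr pair => /=; ring.
  have -> : (ysub (- b)%:P - ysub b%:P) * xsub a
    = xsub a * ysub (- b)%:P + (-1) * (ysub b%:P * xsub a) by ring.
  apply: ID; first by apply: mulI_mem; [exact: xsub_point | exact: ysub_point].
  by apply: IM; apply: mulI_mem; [exact: ysub_point | exact: xsub_point].
have cN0 : 12%:R * a ^+ 2 - D != 0 by apply: ns; rewrite -ab b0 expr0n.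
apply: (ideal_unscale idI cN0).
have -> : ofpoly F (12%:R * a ^+ 2 - D)%:P
  = ofpoly F q - ofpoly F (4%:R%:P * ('X + 2%:R%:P * a%:P)) * xsub a.
  rewrite /xsub -ofpolyM /ofpoly crdD /q; congr pair => /=; ring.
rewrite mulrBl -yy -[X in _ - X]mulrA -mulNr; apply: ID.
  by apply: mulI_mem; exact: ysub_point.
by apply: IM; apply: mulI_mem; exact: xsub_point.
Qed.

(** The line y = L(x) meets the cubic at the three points of the hypothesis;
    both sides have the same norm up to a constant, since the norm of y - L is
    L^2 - F. *)
Lemma mul_collinear x1 x2 x3 L : nonsingular ->
  F - L ^+ 2 = 4%:R%:P * (('X - x1%:P) * ('X - x2%:P) * ('X - x3%:P)) ->
  mulI (mulI (point_ideal x1 L.[x1]) (point_ideal x2 L.[x2]))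
       (point_ideal x3 L.[x3]) = princ (ysub L).
Proof.
move=> ns FL.
have on x : (x == x1) || (x == x2) || (x == x3) -> cubic D E (Some (x, L.[x])).
  move=> xx /=; rewrite -cubic_polyE; apply/eqP; rewrite eq_sym -subr_eq0.
  have -> : F.[x] - L.[x] ^+ 2 = (F - L ^+ 2).[x] by rewrite !hornerE.
  by rewrite FL !(hornerM, hornerC, hornerXsubC); case/orP: xx => [/orP[]|] /eqP->; apply/eqP; ring.
have nE : ysub L * crd_conj (ysub L)
  = ofpoly F (- 4%:R)%:P * (xsub x1 * xsub x2 * xsub x3).
  rewrite mul_conj /xsub -!ofpolyM; congr ofpoly.
  have -> : nrm (ysub L) = - (F - L ^+ 2) by rewrite /nrm /=; ring.
  by rewrite FL; ring.
apply: norm_criterion.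
- exact/ideal_mulI/ideal_point.
- apply: regular_crd; rewrite nE; apply/eqP => /(congr1 (@nrm _ _)) /eqP.
  rewrite !nrmM !nrm_ofpoly expr0n; apply/negP.
  by rewrite !mulf_neq0 ?expf_neq0 ?polyXsubC_eq0 // polyC_eq0 oppr_eq0 pnatr_eq0.
- set N := [set g | exists u v, g = u * (xsub x1 * xsub x2) + v * ysub L].
  have sub12 : mulI (point_ideal x1 L.[x1]) (point_ideal x2 L.[x2]) `<=` N.
    apply: mulIS => [|_ _ [u [v ->]] [u' [v' ->]]|g h].
    + by exists 0, 0; ring.
    + by exists (u + u'), (v + v'); ring.
    + move=> /(point_idealP _ erefl)[u [v ->]] /(point_idealP _ erefl)[u' [v' ->]].
      by exists (u * u'), (u * v' * xsub x1 + v * u' * xsub x2 + v * v' * ysub L); ring.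
  apply: mulIS => [|_ _ [h _ <-] [k _ <-]|g h /sub12[u [v ->]]].
  + by exists 0; rewrite ?mulr0.
  + by exists (h + k); rewrite ?mulrDr.
  + move=> /(point_idealP _ erefl)[u' [v' ->]].
    exists (- u * u' * ofpoly F (4%:R^-1)%:P * crd_conj (ysub L)
            + u * v' * xsub x1 * xsub x2 + v * u' * xsub x3 + v * v' * ysub L) => //.
    have e4 : xsub x1 * xsub x2 * xsub x3
      = - ofpoly F (4%:R^-1)%:P * (ysub L * crd_conj (ysub L)).
      have c1 : - ofpoly F (4%:R^-1)%:P * ofpoly F (- 4%:R)%:P = 1.
        by rewrite mulNr -ofpolyM -polyCM mulrN mulVf ?pnatr_eq0 //
          [LHS]surjective_pairing; congr pair; rewrite /=; ring.
      by rewrite nE -[LHS]mul1r -c1; ring.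
    have -> : (u * (xsub x1 * xsub x2) + v * ysub L) * (u' * xsub x3 + v' * ysub L)
      = u * u' * (xsub x1 * xsub x2 * xsub x3) + ysub L *
        (u * v' * xsub x1 * xsub x2 + v * u' * xsub x3 + v * v' * ysub L) by ring.
    by rewrite e4; ring.
- rewrite !conjI_mul !conj_point mulIACA (mulIACA (point_ideal x1 _)).
  rewrite !mul_point_opp ?princM ?nE ?princ_scale ?oppr_eq0 ?pnatr_eq0 //;
    by apply: on; rewrite eqxx ?orbT.
Qed.

Definition point_class (P : option (K * K)) : set crdF :=
  if P is Some (a, b) then point_ideal a b else [set: crdF].

Definition cubic_opp (P : option (K * K)) : option (K * K) :=
  if P is Some (a, b) then Some (a, - b) else None.

Lemma ideal_point_class P : ideal (point_class P).
Proof. by case: P => [[a b]|]; [exact: ideal_point | exact: ideal_setT]. Qed.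

Lemma cubic_oppP P : cubic D E P -> cubic D E (cubic_opp P).
Proof. by case: P => [[a b]|] //=; rewrite sqrrN. Qed.

Lemma point_class_opp P : nonsingular -> cubic D E P ->
  eqcl (mulI (point_class P) (point_class (cubic_opp P))) [set: crdF].
Proof.
move=> ns; case: P => [[a b]|] PE /=; last by rewrite mul1I //; exact: eqcl_refl.
by rewrite mul_point_opp //; apply/eqcl_princ/regular_crd/xsub_neq0.
Qed.

Lemma cubic_add_opp_eq P Q : cubic_add D P (cubic_opp Q) = None -> P = Q.
Proof.
case: P Q => [[a b]|] [[c d]|] //=; rewrite opprK.
by case: ifP => // /andP[/eqP-> /eqP->].
Qed.

(** The condition on the slope l holds for a chord, after division by x2 - x1,
    and for a tangent, where x1 = x2. *)
Lemma secant_identity x1 y1 x2 l x3 :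
  y1 ^+ 2 = cubic_rhs D E x1 ->
  l * (2%:R * y1 + l * (x2 - x1)) = 4%:R * (x1 ^+ 2 + x1 * x2 + x2 ^+ 2) - D ->
  x3 = l ^+ 2 / 4%:R - x1 - x2 ->
  F - (l%:P * ('X - x1%:P) + y1%:P) ^+ 2
  = 4%:R%:P * (('X - x1%:P) * ('X - x2%:P) * ('X - x3%:P)).
Proof.
rewrite /cubic_rhs => yE lE x3E.
have {}x3E : 4%:R * x3 = l ^+ 2 - 4%:R * (x1 + x2) by rewrite x3E; field.
have -> : 4%:R%:P * (('X - x1%:P) * ('X - x2%:P) * ('X - x3%:P))
  = ('X - x1%:P) * ('X - x2%:P) * (4%:R%:P * 'X - (4%:R * x3)%:P) by ring.
have DE : D = 4%:R * (x1 ^+ 2 + x1 * x2 + x2 ^+ 2) - l * (2%:R * y1 + l * (x2 - x1)).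
  by rewrite lE; ring.
have EE : E = y1 ^+ 2 - 4%:R * x1 ^+ 3 + D * x1 by rewrite yE; ring.
by rewrite x3E /F EE DE; ring.
Qed.

(** Here y = L(x) is the chord through the two points, or the tangent when they
    coincide. *)
Lemma cubic_add_line x1 y1 x2 y2 :
  cubic D E (Some (x1, y1)) -> cubic D E (Some (x2, y2)) ->
  ~~ ((x1 == x2) && (y1 == - y2)) ->
  exists x3 (L : {poly K}),
    [/\ cubic_add D (Some (x1, y1)) (Some (x2, y2)) = Some (x3, - L.[x3]),
        L.[x1] = y1, L.[x2] = y2
      & F - L ^+ 2 = 4%:R%:P * (('X - x1%:P) * ('X - x2%:P) * ('X - x3%:P))].
Proof.
move=> /= P1 P2 ne; rewrite (negPf ne).
set l := if x1 == x2 then _ else _; set x3 := _ / _ - _ - _.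
exists x3, (l%:P * ('X - x1%:P) + y1%:P); split.
- congr (Some (_, - _)); clearbody x3; clearbody l.
  by rewrite !(hornerXsubC, hornerD, hornerM, hornerC); ring.
- clearbody x3; clearbody l.
  by rewrite !(hornerXsubC, hornerD, hornerM, hornerC); ring.
- rewrite !(hornerXsubC, hornerD, hornerM, hornerC) /l.
  have [x12|x12] := eqVneq x1 x2; last by field; rewrite subr_eq0 eq_sym.
  rewrite x12 eqxx /= in ne; rewrite x12 subrr mulr0 add0r.
  move: P1; rewrite x12 -P2 => /eqP; rewrite eqf_sqr (negPf ne) orbF.
  by move/eqP.
- apply: secant_identity => //; rewrite /l.
  have [x12|x12] := eqVneq x1 x2.
    rewrite x12 eqxx /= in ne; move: P1; rewrite x12 -P2 => /eqP.
    rewrite eqf_sqr (negPf ne) orbF => /eqP y12.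
    have yN0 : y1 != 0.
      apply: contraNneq ne => y0; by rewrite -y12 y0 oppr0.
    by field.
  move: P2; rewrite /cubic_rhs => P2.
  have x21 : x2 - x1 != 0 by rewrite subr_eq0 eq_sym.
  apply: (mulfI x21).
  have -> : (x2 - x1) * ((y2 - y1) / (x2 - x1) *
     (2%:R * y1 + (y2 - y1) / (x2 - x1) * (x2 - x1))) = y2 ^+ 2 - y1 ^+ 2 by field.
  by rewrite P1 P2 /cubic_rhs; ring.
Qed.

Lemma collinear_mem x1 x2 x3 (L : {poly K}) :
  F - L ^+ 2 = 4%:R%:P * (('X - x1%:P) * ('X - x2%:P) * ('X - x3%:P)) ->
  cubic D E (Some (x3, - L.[x3])).
Proof.
move=> FL /=; rewrite sqrrN -cubic_polyE; apply/eqP; rewrite eq_sym -subr_eq0.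
have -> : F.[x3] - L.[x3] ^+ 2 = (F - L ^+ 2).[x3] by rewrite !hornerE.
by rewrite FL !(hornerM, hornerXsubC) subrr !mulr0.
Qed.

Lemma cubic_addP P Q : cubic D E P -> cubic D E Q -> cubic D E (cubic_add D P Q).
Proof.
case: P Q => [[x1 y1]|] [[x2 y2]|] PE QE //.
have [eq|ne] := boolP ((x1 == x2) && (y1 == - y2)); first by rewrite /cubic_add eq.
by have [x3 [L [-> _ _ /collinear_mem]]] := cubic_add_line PE QE ne.
Qed.

(** If R is the sum, then -R lies on the line through P and Q, so that
    P, Q and -R have trivial product, as have R and -R. *)
Lemma point_class_add P Q : nonsingular -> cubic D E P -> cubic D E Q ->
  eqcl (point_class (cubic_add D P Q)) (mulI (point_class P) (point_class Q)).
Proof.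
move=> ns; case: P Q => [[x1 y1]|] [[x2 y2]|] PE QE.
- have [/andP[/eqP ex /eqP ey]|ne] := boolP ((x1 == x2) && (y1 == - y2)).
    have -> : cubic_add D (Some (x1, y1)) (Some (x2, y2)) = None.
      by rewrite /cubic_add ex ey !eqxx.
    have -> : Some (x2, y2) = cubic_opp (Some (x1, y1)) by rewrite /= ex ey opprK.
    exact/eqcl_sym/point_class_opp.
  have [x3 [L [-> L1 L2 FL]]] := cubic_add_line PE QE ne.
  exists (ysub L), (xsub x3); split; do ?exact/regular_crd/ysub_neq0.
    exact/regular_crd/xsub_neq0.
  have R3 := collinear_mem FL; rewrite /= -L1 -L2.
  rewrite -(mul_collinear ns FL) -(mul_point_opp ns R3) opprK.
  by rewrite -mulIA [RHS]mulIC; congr mulI; exact: mulIC.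
- by rewrite /= mulI1; [exact: eqcl_refl | exact: ideal_point].
- by rewrite /= mul1I; [exact: eqcl_refl | exact: ideal_point].
- by rewrite /= mul1I; [exact: eqcl_refl | exact: ideal_setT].
Qed.

Lemma size_nrm_neq2 (g : crdF) : size (nrm g) != 2%N.
Proof.
rewrite size_nrm ?size_cubic_poly //.
have odd_case : (size g.1).*2.-1 != 2%N.
  by apply/eqP; case: (size g.1) => // m /(congr1 odd); rewrite /= odd_double.
case: (eqVneq g.2) => [_|g2]; first by rewrite maxn0.
by rewrite /maxn; case: ifP => // _; rewrite !eqSS double_eq0 size_poly_eq0.
Qed.

Lemma point_ideal_horner a b (g : crdF) : cubic D E (Some (a, b)) ->
  point_ideal a b g -> g.1.[a] + g.2.[a] * b = 0.
Proof.
move=> /= ab [u [v ->]].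
have -> : u * xsub a + v * ysub b%:P
  = (u.1 * ('X - a%:P) + F * u.2 * 0 + (v.1 * - b%:P + F * v.2 * 1),
     u.1 * 0 + u.2 * ('X - a%:P) + (v.1 * 1 + v.2 * - b%:P)) by [].
rewrite /= !(cubic_polyE, hornerXsubC, hornerD, hornerM, hornerC, hornerN) -ab.
by ring.
Qed.

(** A generator m would have a norm dividing (x - a)^2 and hence of degree 0 or
    2, since no norm has degree 1; so either m or the cofactor of x - a would
    be a constant. *)
Lemma point_ideal_nonprincipal a b m : cubic D E (Some (a, b)) ->
  point_ideal a b <> princ m.
Proof.
move=> ab e.
have [k _ mk] : princ m (xsub a) by rewrite -e; exact: xsub_point.
have nmk : nrm m * nrm k = ('X - a%:P) ^+ 2 by rewrite -nrmM mk nrm_ofpoly.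
have n0 : nrm m * nrm k != 0 by rewrite nmk expf_neq0 // polyXsubC_eq0.
have [nm0 nk0] : nrm m != 0 /\ nrm k != 0 by apply/andP; rewrite -negb_or -mulf_eq0.
have sz : (size (nrm m) + size (nrm k)).-1 = 3%N.
  by rewrite -size_mul // nmk size_exp_XsubC.
have [sm|sk] : size (nrm m) = 1%N \/ size (nrm k) = 1%N.
  move: (size_nrm_neq2 m) (size_nrm_neq2 k) sz; rewrite -!size_poly_gt0 in nm0 nk0.
  move: (size _) (size _) nm0 nk0 => [|[|[|[|i]]]] [|[|[|[|j]]]] //;
    by [left | right | rewrite ?(addnS, addSn)].
- have /size_poly1P[c c0 nc] : size (nrm m) == 1%N by rewrite sm.
  have : point_ideal a b (m * crd_conj m) by rewrite e; exists (crd_conj m).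
  rewrite mul_conj nc => /(point_ideal_horner ab).
  by rewrite /= hornerC horner0 mul0r addr0; apply/eqP.
- have /size_poly1P[c c0 nc] : size (nrm k) == 1%N by rewrite sk.
  have : princ m (ysub b%:P) by rewrite -e; exact: ysub_point.
  move=> [h _ mh].
  have cE : ofpoly F c%:P * ysub b%:P = xsub a * (crd_conj k * h).
    by rewrite -nc -mul_conj -mh -mk; ring.
  have : c%:P * 1 + 0 * - b%:P = ('X - a%:P) * (crd_conj k * h).2 + 0 * (crd_conj k * h).1.
    exact: (congr1 snd cE).
  rewrite mulr1 !mul0r !addr0 => /(congr1 (horner^~ a)).
  by rewrite hornerM hornerXsubC subrr mul0r hornerC => /eqP; apply/negP.
Qed.

(** If P and Q have the same class, then P - Q has the trivial class, which an
    affine point never has. *)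
Lemma point_class_inj P Q : nonsingular -> cubic D E P -> cubic D E Q ->
  eqcl (point_class P) (point_class Q) -> P = Q.
Proof.
move=> ns PE QE PQ; apply: cubic_add_opp_eq.
have QE' := cubic_oppP QE; have RE := cubic_addP PE QE'.
have : eqcl (point_class (cubic_add D P (cubic_opp Q))) [set: crdF].
  apply: eqcl_trans (point_class_add ns PE QE') _.
  apply: eqcl_trans (point_class_opp ns QE).
  exact: eqclM PQ (eqcl_refl _).
move: RE; case: cubic_add => [[a b]|] // RE /eqcl1P-[|g].
  exact: ideal_point.
by move/(point_ideal_nonprincipal RE).
Qed.

Section Translation.
Variable P0 : option (K * K).
Hypotheses (ns : nonsingular) (P0E : cubic D E P0).

Local Notation T := (fun P => cubic_add D P P0).

Lemma iter_add_mem n P : cubic D E P -> cubic D E (iter n T P).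
Proof. by move=> PE; elim: n => //= n IH; exact: cubic_addP. Qed.

Lemma point_class_iter n P : cubic D E P ->
  eqcl (point_class (iter n T P)) (mulI (point_class P) (expI (point_class P0) n)).
Proof.
move=> PE; elim: n => [|n IH] /=.
  by rewrite mulI1; [exact: eqcl_refl | exact: ideal_point_class].
apply: eqcl_trans (point_class_add ns (iter_add_mem n PE) P0E) _.
rewrite mulIC mulICA; exact: eqclM (eqcl_refl _) IH.
Qed.

Lemma iter_add_None n :
  iter n T None = None <-> eqcl (expI (point_class P0) n) [set: crdF].
Proof.
have := @point_class_iter n None I.
rewrite [point_class None]/(setT) mul1I; last exact: ideal_expI.
move=> clT; split=> [eN|e].
  by apply: eqcl_sym; rewrite eN in clT.
by apply: (point_class_inj ns) => //; [exact: iter_add_mem | exact: eqcl_trans e].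
Qed.

(** The n-th iterate multiplies the class of every point by the same class,
    and a point is determined by its class. *)
Lemma n_periodic_add n : n_periodic (cubic D E) T n <-> iter n T None = None.
Proof.
split=> [|/iter_add_None e P PE]; first exact.
apply: (point_class_inj ns) => //; first exact: iter_add_mem.
apply: eqcl_trans (point_class_iter n PE) _.
rewrite -[X in eqcl _ X](mulI1 (ideal_point_class P)).
exact: eqclM (eqcl_refl _) e.
Qed.

End Translation.

End ClassMap.

(** * Multiples of a point and Pade approximation *)

Section PowerOfPoint.
Context {K : numFieldType} (D E X0 Y0 : K).
Hypotheses (ns : nonsingular D E) (P0E : cubic D E (Some (X0, Y0))).
Local Notation F := (cubic_poly D E).
Local Notation crdF := (crd F).
Local Notation t := ('X - X0%:P).
Local Notation M := (@point_ideal _ D E X0 Y0).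

Context (S : {poly K}) (n : nat).
Hypotheses (FS : t ^+ n %| F - S ^+ 2) (SX0 : S.[X0] = Y0).

(** Restriction to the branch y = S(x) of the curve at (X0, Y0). *)
Definition branch (g : crdF) : {poly K} := g.1 + g.2 * S.

Lemma branchM g h : branch (g * h) = branch g * branch h + g.2 * h.2 * (F - S ^+ 2).
Proof. by rewrite /branch crdM /=; ring. Qed.

Lemma dvdp_branchM k l m g h : (m <= k + l)%N -> (m <= n)%N ->
  t ^+ k %| branch g -> t ^+ l %| branch h -> t ^+ m %| branch (g * h).
Proof.
move=> mkl mn kg lh; rewrite branchM; apply: dvdp_add.
  apply: dvdp_trans (dvdp_mul kg lh); rewrite -exprD.
  exact: dvdp_exp2l.
by apply/dvdp_mull/(dvdp_trans _ FS)/dvdp_exp2l.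
Qed.

(** Along y = S(x) the local parameter at the point is t = x - X0, so that
    vanishing to order k is a condition modulo t^k. *)
Lemma expI_branch k : (k <= n)%N -> expI M k `<=` [set g | t ^+ k %| branch g].
Proof.
elim: k => [|k IH] kn g /=; first by rewrite expr0 dvd1p.
move: g; apply: mulIS => [|g h /= gd hd|g h]; rewrite ?[LHS]/=.
- by rewrite /branch /= mul0r addr0 dvdp0.
- have -> : branch (g + h) = branch g + branch h by rewrite /branch crdD /=; ring.
  exact: dvdp_add.
move=> /(point_idealP _ SX0)[u [v ->]] /(IH (ltnW kn)) /= hd.
apply: (@dvdp_branchM 1 k) => //.
have -> : branch (u * xsub D E X0 + v * ysub D E S)
  = branch u * t + v.2 * (F - S ^+ 2).
  by rewrite /branch crdD !crdM /=; ring.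
rewrite expr1; apply: dvdp_add; first exact: dvdp_mull.
apply/dvdp_mull/(dvdp_trans _ FS); rewrite -{1}[t]expr1; apply: dvdp_exp2l.
by case: (n) kn.
Qed.

(** If g and h vanish to order n on the branch, then both components of
    h * crd_conj g are divisible by t^n, that is, by the norm of g, so that g
    divides h. *)
Lemma branch_princ g : g != 0 -> (size (nrm g) <= n.+1)%N -> t ^+ n %| branch g ->
  (exists2 c, c != 0 & nrm g = c%:P * t ^+ n)
  /\ [set h : crdF | t ^+ n %| branch h] `<=` princ g.
Proof.
move=> gN0 sg gd.
have nN0 : nrm g != 0 by exact: nrm_neq0 (size_cubic_poly D E) gN0.
have [c cN0 nE] : exists2 c, c != 0 & nrm g = c%:P * t ^+ n.
  have /dvdpP[q qE] : t ^+ n %| nrm g.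
    have -> : nrm g = (g.1 - g.2 * S) * branch g - g.2 ^+ 2 * (F - S ^+ 2).
      by rewrite /nrm /branch; ring.
    by apply: dvdp_sub; apply: dvdp_mull.
  have qN0 : q != 0 by apply: contraNneq nN0 => q0; rewrite qE q0 mul0r.
  have : size q == 1%N.
    rewrite -size_poly_gt0 in qN0; move: sg; rewrite qE size_Mmonic -?size_poly_gt0 //.
      by rewrite size_exp_XsubC; lia.
    exact/monic_exp/monicXsubC.
  by move=> /size_poly1P[c c0 qc]; exists c; rewrite // qE qc.
split; first by exists c.
move=> h /= hd; set p : crdF := h * crd_conj g.
have p_dvd : t ^+ n %| p.1 /\ t ^+ n %| p.2.
  have d1 : t ^+ n %| (p.1 + p.2 * S) - (p.1 + p.2 * S) by rewrite subrr dvdp0.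
  have pE1 : p.1 = h.1 * g.1 - F * h.2 * g.2 by rewrite /p crdM /crd_conj /=; ring.
  have pE2 : p.2 = h.2 * g.1 - h.1 * g.2 by rewrite /p crdM /crd_conj /=; ring.
  have p2 : t ^+ n %| p.2.
    have -> : p.2 = h.2 * branch g - branch h * g.2 by rewrite pE2 /branch; ring.
    by apply: dvdp_sub; [apply: dvdp_mull | apply: dvdp_mulr].
  split=> //.
  have -> : p.1 = h.1 * branch g - S * (h.1 * g.2) - F * h.2 * g.2.
    by rewrite pE1 /branch; ring.
  have -> : h.1 * branch g - S * (h.1 * g.2) - F * h.2 * g.2
    = h.1 * branch g - S * g.2 * branch h - h.2 * g.2 * (F - S ^+ 2).
    by rewrite /branch; ring.
  by do ?apply: dvdp_sub; apply: dvdp_mull.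
case: p_dvd => /dvdpP[a aE] /dvdpP[b bE].
exists (ofpoly F c^-1%:P * (a, b)) => //.
apply: (@crd_cancel _ _ (crd_conj g)); first exact: size_cubic_poly.
  by apply: contraNneq gN0 => e; rewrite -[g]conjK e conj0.
have -> : crd_conj g * (g * (ofpoly F c^-1%:P * (a, b)))
  = ofpoly F c^-1%:P * (g * crd_conj g) * (a, b) by ring.
rewrite mul_conj -ofpolyM nE mulrA -polyCM mulVf // mul1r [RHS]mulrC -/p.
rewrite [RHS]surjective_pairing aE bE /ofpoly crdM /=.
by congr pair; ring.
Qed.

Lemma conjI_princ g : conjI (princ g) = princ (crd_conj g) :> set crdF.
Proof.
apply/seteqP; split=> h; rewrite /conjI /=.
  by move=> [k _ kE]; exists (crd_conj k); rewrite // -conjM kE conjK.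
by move=> [k _ <-]; exists (crd_conj k); rewrite // conjM conjK.
Qed.

(** A generator of M^n has norm t^n up to a constant; conversely a function
    with this norm that vanishes to order n on the branch generates M^n. *)
Lemma expI_principal :
  eqcl (expI M n) [set: crdF] <->
  exists g : crdF, [/\ g != 0, (size (nrm g) <= n.+1)%N & t ^+ n %| branch g].
Proof.
have nE : mulI (expI M n) (conjI (expI M n)) = princ (ofpoly F (t ^+ n)).
  rewrite mulI_conj_exp conj_point mul_point_opp // expI_princ.
  by rewrite /xsub -ofpolyX.
have tN0 : t ^+ n != 0 by rewrite expf_neq0 // polyXsubC_eq0.
split=> [/eqcl1P-[|g gE]|[g [gN0 sg gd]]].
- exact: ideal_expI.
- have [k _ ke] : princ (g * crd_conj g) (ofpoly F (t ^+ n)).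
    by rewrite -princM -conjI_princ -gE nE; exact: princ_mem.
  have gk : nrm g * k.1 = t ^+ n.
    move/(congr1 fst): ke; rewrite mul_conj crdM /= => <-; ring.
  exists g; split.
  + apply: contraNneq tN0 => g0; rewrite -gk g0 /nrm /=; apply/eqP; ring.
  + rewrite -(size_exp_XsubC n X0); apply: dvdp_leq => //.
    by rewrite -gk; exact: dvdp_mulr.
  + by apply: (expI_branch (leqnn n)); rewrite gE; exact: princ_mem.
have [[c cN0 ngE] sub] := branch_princ gN0 sg gd.
have gcE : g * crd_conj g = ofpoly F c%:P * ofpoly F (t ^+ n).
  by rewrite mul_conj ngE ofpolyM.
have gcN0 : g * crd_conj g != 0.
  rewrite mul_conj; apply/eqP => -[/eqP].
  by rewrite (negPf (nrm_neq0 (size_cubic_poly D E) gN0)).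
have -> : expI M n = princ g.
  apply: norm_criterion.
  - exact: ideal_expI.
  - exact: regular_crd.
  - exact: subset_trans (expI_branch (leqnn n)) sub.
  - by rewrite gcE princ_scale.
exact/eqcl_princ/regular_crd.
Qed.

End PowerOfPoint.

Lemma dvdp_XnP {K : fieldType} n (p : {poly K}) :
  reflect (forall i, (i < n)%N -> p`_i = 0) ('X^n %| p).
Proof.
apply: (iffP idP) => [/dvdpP[q ->] i lin|p0]; first by rewrite coefMXn lin.
rewrite -[p](poly_take_drop n); apply: dvdp_add; last exact: dvdp_mull.
suff -> : take_poly n p = 0 by exact: dvdp0.
by apply/polyP => i; rewrite coef_take_poly coef0; case: ifP => // /p0.
Qed.

(** Pade approximation: eliminating A, the condition on B consists of m linear
    equations for its m coefficients, whose matrix is a Hankel matrix up to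
    the order of the unknowns. *)
Lemma pade_hankel {K : fieldType} (C : nat -> K) (P : {poly K}) k m s :
  (s + m = k.+2)%N -> (forall i, (i < k.+1 + m)%N -> P`_i = C i) ->
  (exists A B : {poly K}, [/\ (A, B) != 0, (size A <= k.+1)%N, (size B <= m)%N
     & 'X^(k.+1 + m) %| A + B * P])
  <-> \det (\matrix_(i < m, j < m) C (s + i + j)%N) = 0.
Proof.
move=> sm PC; set H := \matrix_(_, _) _.
have coefBP (B : {poly K}) (v : 'rV_m) (i : 'I_m) : (size B <= m)%N ->
    (forall j : 'I_m, v 0 j = B`_(rev_ord j)) -> (B * P)`_(k.+1 + i) = (v *m H) 0 i.
  move=> sB vB; rewrite coefM mxE.
  rewrite -(big_mkord xpredT (fun j => B`_j * P`_(k.+1 + i - j))).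
  rewrite (big_cat_nat (n := m)) //=; last by have := ltn_ord i; lia.
  rewrite [X in _ + X]big_nat_cond [X in _ + X]big1 ?addr0 => [|j]; last first.
    rewrite andbT => /andP[mj _].
    by rewrite [B`_j]nth_default ?mul0r //; exact: leq_trans mj.
  rewrite big_mkord (reindex_inj rev_ord_inj) /=; apply: eq_bigr => j _.
  have := ltn_ord i; have := ltn_ord j => jm im.
  by rewrite mxE vB /= PC; [congr (_ * C _); lia | lia].
split=> [[A [B [ABN0 sA sB /dvdp_XnP AB0]]]|/eqP/det0P[v vN0 vH]].
  apply/eqP/det0P; exists (\row_j B`_(rev_ord j)).
    apply: contra ABN0 => /eqP/rowP v0.
    have B0 : B = 0.
      apply/polyP => j; rewrite coef0; have [mj|jm] := leqP m j.
        by rewrite nth_default //; exact: leq_trans mj.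
      by have := v0 (rev_ord (Ordinal jm)); rewrite !mxE rev_ordK.
    apply/eqP; congr pair => //; apply/polyP => j; rewrite coef0.
    have [kj|jk] := leqP k.+1 j; first by rewrite nth_default //; exact: leq_trans kj.
    by have := AB0 j; rewrite B0 mul0r addr0; apply; exact: ltn_addr.
  apply/rowP => i; rewrite -(coefBP B) // => [|j]; rewrite !mxE //.
  have := AB0 (k.+1 + i)%N; rewrite ltn_add2l ltn_ord coefD => /(_ isT).
  by rewrite [A`_ _]nth_default ?add0r // (leq_trans sA) // leq_addr.
have rE (j : 'I_m) : (\poly_(j < m) (if insub j is Some l then v 0 (rev_ord l) else 0))`_(rev_ord j) = v 0 j.
  by rewrite coef_poly ltn_ord valK rev_ordK.
move: rE; set B := \poly_(_ < _) _ => BE.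
have sB : (size B <= m)%N by exact: size_poly.
exists (- take_poly k.+1 (B * P)), B; split=> //.
- apply: contra vN0 => /eqP[_ B0]; apply/eqP/rowP => j.
  by rewrite -BE B0 coef0 mxE.
- by rewrite size_polyN size_take_poly.
- apply/dvdp_XnP => i lti; rewrite coefD coefN coef_take_poly.
  case: ltnP => ki; first by rewrite addNr.
  have im : (i - k.+1 < m)%N by lia.
  have -> : i = (k.+1 + Ordinal im)%N by rewrite /=; lia.
  by rewrite (coefBP _ v) // vH mxE oppr0 add0r.
Qed.

(** With n = k + 1 + m, the functions with at most an n-fold pole at infinity are
    the A + B y with deg A <= k and deg B < m, since x and y have poles of order
    2 and 3 there. *)
Lemma iter_add_hankel {K : numFieldType} (D E X0 Y0 : K) (C : nat -> K) k m s :
  nonsingular D E -> cubic D E (Some (X0, Y0)) -> C 0%N = Y0 ->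
  (forall i, \sum_(j < i.+1) C j * C (i - j)%N
             = (cubic_poly D E \Po ('X + X0%:P))`_i) ->
  (s + m = k.+2)%N -> (m == k) || (m.+1 == k) ->
  iter (k.+1 + m) (fun P => cubic_add D P (Some (X0, Y0))) None = None <->
  \det (\matrix_(i < m, j < m) C (s + i + j)%N) = 0.
Proof.
move=> ns P0E C0 Csq sm mk; set n := (k.+1 + m)%N.
pose P := \poly_(i < n) C i; pose S := P \Po ('X - X0%:P).
have PC i : (i < n)%N -> P`_i = C i by move=> lin; rewrite coef_poly lin.
have shiftK (p : {poly K}) : (p \Po ('X + X0%:P)) \Po ('X - X0%:P) = p.
  by rewrite -comp_polyA comp_polyD comp_polyX comp_polyC subrK comp_polyXr.
have shiftVK (p : {poly K}) : (p \Po ('X - X0%:P)) \Po ('X + X0%:P) = p.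
  by rewrite -comp_polyA comp_polyB comp_polyX comp_polyC addrK comp_polyXr.
have dvd_shift (p : {poly K}) :
    (('X - X0%:P) ^+ n %| p) = ('X^n %| p \Po ('X + X0%:P)).
  apply/idP/idP => /dvdpP[q].
    move=> ->; rewrite comp_polyM rmorphXn /= comp_polyB comp_polyX comp_polyC addrK.
    exact: dvdp_mull.
  move=> e; rewrite -[p]shiftK e comp_polyM rmorphXn /= comp_polyX.
  exact: dvdp_mull.
have FS : ('X - X0%:P) ^+ n %| cubic_poly D E - S ^+ 2.
  rewrite dvd_shift comp_polyB rmorphXn /= shiftVK; apply/dvdp_XnP => i lin.
  rewrite coefB -Csq expr2 coefM; apply/eqP; rewrite subr_eq0; apply/eqP.
  apply: eq_bigr => j _; have := ltn_ord j => ji.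
  by rewrite !PC //; lia.
have SX0 : S.[X0] = Y0.
  by rewrite horner_comp !hornerE subrr horner_coef0 PC.
apply: (iff_trans (iter_add_None ns P0E n)); apply: (iff_trans (expI_principal ns P0E FS SX0)).
rewrite -(pade_hankel sm PC).
have sz (g : crd (cubic_poly D E)) :
  (size (nrm g) <= n.+1)%N = (size g.1 <= k.+1)%N && (size g.2 <= m)%N.
  rewrite size_nrm ?size_cubic_poly // geq_max; congr andb; first by rewrite /n; lia.
  by case: eqVneq => [->|_]; rewrite ?size_poly0 // /n; lia.
split=> [[g [gN0]]|[A [B [ABN0 sA sB AB]]]].
  rewrite sz => /andP[sA sB]; rewrite dvd_shift => gd.
  exists (g.1 \Po ('X + X0%:P)), (g.2 \Po ('X + X0%:P)).
  split; rewrite ?size_comp_poly2 ?size_XaddC //; last first.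
    by rewrite -[P]shiftVK -comp_polyM -comp_polyD.
  apply: contra gN0 => /eqP[g1 g2]; apply/eqP.
  by rewrite [g]surjective_pairing -[g.1]shiftK -[g.2]shiftK g1 g2 !comp_poly0.
exists (A \Po ('X - X0%:P), B \Po ('X - X0%:P)); split.
- apply: contra ABN0 => /eqP[g1 g2]; apply/eqP.
  by rewrite -[A]shiftVK -[B]shiftVK g1 g2 !comp_poly0.
- by rewrite sz /= !size_comp_poly2 ?size_XsubC // sA sB.
- by rewrite dvd_shift /branch /= comp_polyD comp_polyM !shiftVK.
Qed.

(** * Taylor coefficients of the square root *)

Section SqrtTaylorPolynomials.
Context {K : numFieldType} (F : {poly K}).

(** The numerators of the Taylor coefficients of a square root s of F: its k-th
    derivative is k! (sqrt_num k) / s^(2k+1). *)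
Fixpoint sqrt_num (k : nat) : {poly K} :=
  if k is i.+1 then
    i.+1%:R^-1 *: ((sqrt_num i)^`() * F - (i%:R + 2%:R^-1) *: (sqrt_num i * F^`()))
  else F.

Lemma sqrt_numS i : i.+1%:R *: sqrt_num i.+1
  = (sqrt_num i)^`() * F - (i%:R + 2%:R^-1) *: (sqrt_num i * F^`()).
Proof. by rewrite scalerA mulfV ?pnatr_eq0 // scale1r. Qed.

(** The Leibniz rule for Taylor coefficients, with k + 1 = i + (k + 1 - i). *)
Lemma convolution_shift (a : nat -> {poly K}) k :
  \sum_(i < k.+1) (i.+1%:R *: a i.+1 * a (k - i)%N)
  + \sum_(i < k.+1) (a i * ((k - i).+1%:R *: a (k - i).+1))
  = k.+1%:R *: \sum_(i < k.+2) (a i * a (k.+1 - i)%N).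
Proof.
have -> : k.+1%:R *: \sum_(i < k.+2) (a i * a (k.+1 - i)%N)
  = \sum_(i < k.+2) (i%:R *: a i * a (k.+1 - i)%N)
    + \sum_(i < k.+2) (a i * ((k.+1 - i)%:R *: a (k.+1 - i)%N)).
  rewrite scaler_sumr -big_split; apply: eq_bigr => i _ /=.
  rewrite -scalerAl -scalerAr -scalerDl -natrD subnKC //.
  by rewrite -ltnS.
congr (_ + _).
  rewrite [RHS]big_ord_recl /= mulr0n scale0r mul0r add0r; apply: eq_bigr => i _.
  by rewrite /bump /= add1n subSS.
rewrite [RHS]big_ord_recr /= subnn mulr0n scale0r mulr0 addr0; apply: eq_bigr => i _.
by rewrite subSn // -ltnS.
Qed.

(** The convolution square of the Taylor coefficients of s is the sequence of
    Taylor coefficients of s^2 = F, by induction with the derivation rule. *)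
Lemma sqrt_num_conv k :
  \sum_(i < k.+1) (sqrt_num i * sqrt_num (k - i)) = F^`N(k) * F ^+ k.+1.
Proof.
elim: k => [|k IH]; first by rewrite big_ord1 nderivn0 expr1.
set a := sqrt_num in IH *.
have kN0 : k.+1%:R != 0 :> K by rewrite pnatr_eq0.
apply: (scalerI kN0); rewrite -convolution_shift.
have -> : \sum_(i < k.+1) (i.+1%:R *: a i.+1 * a (k - i)%N)
  + \sum_(i < k.+1) (a i * ((k - i).+1%:R *: a (k - i).+1))
  = (\sum_(i < k.+1) (a i * a (k - i)%N))^`() * F
    - k.+1%:R *: (\sum_(i < k.+1) (a i * a (k - i)%N)) * F^`().
  rewrite raddf_sum /= scaler_sumr !mulr_suml -sumrB -big_split; apply: eq_bigr => i _ /=.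
  rewrite !sqrt_numS derivM.
  have -> : k.+1%:R = (i%:R + 2%:R^-1) + ((k - i)%:R + 2%:R^-1) :> K.
    have ik : (i <= k)%N by rewrite -ltnS.
    by rewrite natrB // -[k.+1%:R]natr1; field.
  rewrite -!mul_polyC /a; ring.
rewrite IH derivM deriv_exp /= -!mul_polyC.
have -> : (F^`N(k))^`() = k.+1%:R%:P * F^`N(k.+1).
  apply/polyP => i; rewrite coef_deriv mul_polyC coefZ !coef_nderivn addnS addSn.
  rewrite -!mulrnA [RHS]mulr_natl -mulrnA; congr (_ *+ _).
  have := mul_bin_diag (k + i).+1 k; have := mul_bin_down (k + i).+1 k; lia.
by rewrite !exprS; ring.
Qed.
End SqrtTaylorPolynomials.

Section SqrtDerivatives.
Context {K : numFieldType}.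

Lemma is_derive_horner_num (p : {poly K}) (x : K) :
  is_derive x (1 : K) (horner p : K -> K) p^`().[x].
Proof.
elim/poly_ind: p => [|p r IH].
  rewrite deriv0 horner0 (_ : horner 0 = cst 0); first exact: is_derive_cst.
  by apply/funext => y; rewrite horner0.
rewrite (_ : horner _ = (horner p : K -> K) * id + cst r); last first.
  by apply/funext => y; rewrite hornerMXaddC.
apply: is_derive_eq.
by rewrite derivMXaddC hornerD hornerM hornerX /GRing.scale /=; ring.
Qed.

(** Difference quotients: s(y) - s(x) = (f(y) - f(x)) / (s(y) + s(x)). *)
Lemma is_derive_sqrt (f s : K -> K) (x df : K) :
  (forall y, s y ^+ 2 = f y) -> {for x, continuous s} -> s x != 0 ->
  is_derive x (1 : K) f df -> is_derive x (1 : K) s (df / (2%:R * s x)).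
Proof.
move=> s2 sc sx0 [fx dfE].
have s2x0 : s x + s x != 0 by rewrite -mulr2n mulrn_eq0.
have sh : s (h *: 1 + x) @[h --> 0^'] --> s x.
  have h0 : (h *: (1 : K) + x) @[h --> (0 : K)] --> (0 : K) *: (1 : K) + x.
    have h1 : (h : K) @[h --> (0 : K)] --> (0 : K) by exact: cvg_id.
    have h2 : (h *: (1 : K)) @[h --> (0 : K)] --> (0 : K) *: (1 : K) by exact: cvgZr_tmp h1.
    exact: cvgD h2 (cvg_cst x).
  rewrite scale0r add0r in h0.
  apply: (@cvg_comp _ _ _ (fun h : K => h *: (1 : K) + x) s _ (nbhs x)) => //.
  by apply: cvg_within_filter; exact: h0.
have shx : s (h *: 1 + x) + s x @[h --> 0^'] --> s x + s x.
  by apply: cvgD => //; exact: cvg_cst.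
have main : h^-1 *: ((s \o shift x) (h *: 1) - s x) @[h --> 0^'] --> df / (2%:R * s x).
  have : (s (h *: 1 + x) + s x)^-1 * (h^-1 *: ((f \o shift x) (h *: 1) - f x)) @[h --> 0^']
      --> (s x + s x)^-1 * df.
    by apply: cvgM; [exact: cvgV | rewrite -dfE; exact: fx].
  have -> : (s x + s x)^-1 * df = df / (2%:R * s x) by rewrite mulrC mulr_natl mulr2n.
  apply: cvg_trans; apply: near_eq_cvg.
  near=> h => /=.
  have n0 : s (h *: 1 + x) + s x != 0.
    near: h; apply: (shx [set z | z != 0]); exists `|s x + s x|.
      by rewrite /= normr_gt0.
    by move=> y /= lty; apply/eqP => y0; move: lty; rewrite y0 subr0 ltxx.
  move: n0; rewrite -!s2 /GRing.scale /= => n0.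
  by move: (h^-1) (s (h * 1 + x)) n0 => k u n0; field.
by apply: DeriveDef; [apply/cvg_ex; eexists; exact: main | exact: cvg_lim main].
Unshelve. all: by end_near.
Qed.

(** With s^2 = F, the derivative of p / s^m is (p' F - m p F' / 2) / s^(m+2). *)
Lemma derive1n_sqrt (F : {poly K}) (s : K -> K) (U : set K) :
  (forall x, s x ^+ 2 = F.[x]) -> (forall x, U x -> \forall y \near x, U y) ->
  (forall x, U x -> s x != 0) -> (forall x, U x -> {for x, continuous s}) ->
  forall k x, U x ->
    derive1n k s x = k`!%:R * (sqrt_num F k).[x] / s x ^+ (2 * k).+1.
Proof.
move=> s2 Uo s0 sc; elim=> [|k IH] x Ux.
  by rewrite derive1n0 /= -s2 muln0 expr1 fact0 mul1r expr2 mulfK // s0.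
rewrite derive1nS derive1E.
set G : K -> K := fun y => k`!%:R * (sqrt_num F k).[y] / s y ^+ (2 * k).+1.
rewrite (@near_eq_derive _ _ _ _ G); last first.
  by near=> y; apply: IH; near: y; exact: Uo.
have ds : is_derive x (1 : K) s (F^`().[x] / (2%:R * s x)).
  apply: (is_derive_sqrt (f := horner F)) => //; [exact: sc | exact: s0 | exact: is_derive_horner_num].
have sx0 := s0 x Ux.
have dr : is_derive x (1 : K) (fun y => (s y)^-1) (- s x ^- 2 *: (F^`().[x] / (2%:R * s x))).
  apply: DeriveDef; first by apply: derivableV => //; exact: ex_derive.
  by rewrite deriveV // derive_val.
have GE : G = (cst k`!%:R * (horner (sqrt_num F k) : K -> K)) * (fun y => (s y)^-1) ^+ (2 * k).+1.
  by apply/funext => y; rewrite /G !fctE /= exprVn.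
have dp := is_derive_horner_num (sqrt_num F k) x.
have dG : is_derive x (1 : K) G
   (k.+1`!%:R * (sqrt_num F k.+1).[x] / s x ^+ (2 * k.+1).+1).
  rewrite GE; apply: is_derive_eq.
  rewrite /GRing.scale !fctE /= !(hornerZ, hornerD, hornerN, hornerM) -s2.
  rewrite !exprVn mulnS !addSn add0n !(exprS (s x)) factS natrM.
  have e0 : s x ^+ (2 * k) != 0 by rewrite expf_neq0.
  field.
  by rewrite e0 sx0 addrC natr1 pnatr_eq0.
by rewrite derive_val.
Unshelve. all: by end_near.
Qed.

Lemma lipschitz_at_continuous (w : K -> K) (z0 r : K) : 0 < r ->
  (forall z, `|w z0 - w z| * r <= `|z0 - z|) -> {for z0, continuous w}.
Proof.
move=> r0 lip; apply/(@cvgrPdist_lt _ _ _ (nbhs z0) (nbhs_filter z0)) => e e0; near=> z.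
rewrite -(ltr_pM2r r0); apply: (le_lt_trans (lip z)).
near: z; exists (e * r); first by rewrite /= mulr_gt0.
by move=> y.
Unshelve. all: by end_near.
Qed.

Lemma continuous_horner_num (p : {poly K}) (x : K) : {for x, continuous (horner p)}.
Proof.
have [dp _] := is_derive_horner_num p x.
exact: (differentiable_continuous (iffLR (derivable1_diffP _ _) dp)).
Qed.

Lemma continuous_mulr_cst (w : K -> K) (c x : K) :
  {for x, continuous w} -> {for x, continuous (fun y => w y * c)}.
Proof. by move=> wc; exact: cvgM wc (cvg_cst _). Qed.

End SqrtDerivatives.

Section SqrtBranch.
Context {R : realType}.
Local Notation C := (Num.NumField.sort (R[i] : numFieldType)).

Lemma Re_sqrtc_ge0 (z : C) : 0 <= complex.Re (sqrtc z).
Proof. by case: z => a b; exact: sqrtr_ge0. Qed.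

Lemma ReB_le (z w : C) : (complex.Re z - complex.Re w)%:C%C <= `|z - w|.
Proof.
apply: le_trans (normc_ge_Re _); rewrite lecR; apply: le_trans (ler_norm _) _.
by case: z w => [a b] [c d].
Qed.

(** w - w0 = (z - z0) / (w + w0), where the real part of w + w0 is at least
    that of w0 because the principal branch takes values in Re >= 0. *)
Lemma sqrtc_continuous (z0 : C) : 0 < complex.Re (sqrtc z0) -> {for z0, continuous (fun z : C => sqrtc z : C)}.
Proof.
move=> r0; have r0' : 0 < (complex.Re (sqrtc z0))%:C%C by rewrite ltcR.
apply: (lipschitz_at_continuous r0') => z.
have -> : z0 - z = (sqrtc z0 - sqrtc z) * (sqrtc z0 + sqrtc z).
  by rewrite -subr_sqr !sqr_sqrtc.
rewrite normrM.
rewrite ler_wpM2l //; apply: le_trans (normc_ge_Re _); rewrite lecR.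
rewrite (le_trans _ (ler_norm _)) //.
have := Re_sqrtc_ge0 z; case: (sqrtc z0) (sqrtc z) => [a b] [c d] /= c0.
by rewrite lerDl.
Qed.

Variables (A : 'M[R[i]]_3).
Hypothesis Y0N0 : Y0 A != 0.
Local Notation F := (cubic_poly (D_curve A) (E_curve A)).
Hypothesis P0E : Y0 A ^+ 2 = cubic_rhs (D_curve A) (E_curve A) (X0 A).

Lemma sqr_sqrt_branch x : sqrt_branch A x ^+ 2 = F.[x].
Proof.
rewrite /sqrt_branch exprMn sqr_sqrtc cubic_polyE mulrC divfK //.
by rewrite expf_neq0.
Qed.

Lemma sqrt_branch_X0 : sqrt_branch A (X0 A) = Y0 A.
Proof. by rewrite /sqrt_branch -P0E divff ?expf_neq0 // sqrtc1 mulr1. Qed.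

(** The set where the principal square root has positive real part is open,
    contains X0, and the branch is differentiable there. *)
Lemma taylor_coefE k :
  taylor_coef A k = (sqrt_num F k).[X0 A] / Y0 A ^+ (2 * k).+1.
Proof.
pose w (x : C) : C := sqrtc (F.[x] / Y0 A ^+ 2).
pose U := [set x | 0 < complex.Re (w x)].
have sE x : sqrt_branch A x = Y0 A * w x by rewrite /sqrt_branch -cubic_polyE.
have Fc x : {for x, continuous (fun x => F.[x] / Y0 A ^+ 2)}.
  exact: (continuous_mulr_cst (@continuous_horner_num _ F x)).
have wc x : U x -> {for x, continuous w}.
  by move=> Ux; apply: continuous_comp; [exact: Fc | exact: sqrtc_continuous].
have Uo x : U x -> \forall y \near x, U y.
  move=> Ux; have /cvgrPdist_lt/(_ (complex.Re (w x))%:C%C) := wc x Ux.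
  rewrite ltcR => /(_ Ux); apply: filterS => y /=.
  move=> /(le_lt_trans (ReB_le _ _)); rewrite ltcR /U /=.
  by rewrite ltrBlDr ltrDl.
have UX0 : U (X0 A) by rewrite /U /= /w cubic_polyE -P0E divff ?expf_neq0 // sqrtc1 ltr01.
have s0 x : U x -> sqrt_branch A x != 0.
  move=> Ux; rewrite sE mulf_neq0 //; apply: contraTneq Ux => w0.
  by rewrite /U /= w0 ltxx.
have sc x : U x -> {for x, continuous (sqrt_branch A : C -> C)}.
  move=> Ux; rewrite (_ : sqrt_branch A = (fun x => w x * Y0 A)).
    by apply: continuous_mulr_cst; exact: wc.
  by apply/funext => y; rewrite sE mulrC.
have kN0 : k`!%:R != 0 :> C by rewrite pnatr_eq0 -lt0n fact_gt0.
rewrite /taylor_coef /taylor.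
have -> := @derive1n_sqrt _ F (sqrt_branch A) U sqr_sqrt_branch Uo s0 sc k (X0 A) UX0.
by rewrite sqrt_branch_X0 -[_ * _ / Y0 A ^+ _]mulrA mulrC mulKf.
Qed.

Lemma taylor_coef0 : taylor_coef A 0 = Y0 A.
Proof. by rewrite taylor_coefE /= cubic_polyE -P0E expr1 expr2 mulfK. Qed.

Lemma taylor_coef_conv i :
  \sum_(j < i.+1) taylor_coef A j * taylor_coef A (i - j)
  = (F \Po ('X + (X0 A)%:P))`_i.
Proof.
have -> : \sum_(j < i.+1) taylor_coef A j * taylor_coef A (i - j)
  = (\sum_(j < i.+1) sqrt_num F j * sqrt_num F (i - j)).[X0 A] / (Y0 A ^+ 2) ^+ i.+1.
  rewrite horner_sum mulr_suml; apply: eq_bigr => j _; rewrite !taylor_coefE hornerM.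
  have -> : (Y0 A ^+ 2) ^+ i.+1 = Y0 A ^+ (2 * j).+1 * Y0 A ^+ (2 * (i - j)).+1.
    by rewrite -exprM -exprD; congr (_ ^+ _); have := ltn_ord j; lia.
  by rewrite invfM mulrACA.
rewrite sqrt_num_conv hornerM horner_exp cubic_polyE -P0E mulfK ?expf_neq0 //.
rewrite /comp_poly addrC nderiv_taylor; last exact: mulrC.
rewrite size_map_polyC size_cubic_poly coef_sum.
transitivity (\sum_(j < 4) if i == j then F^`N(i).[X0 A] else 0); last first.
  apply: eq_bigr => j _; rewrite nderivn_map horner_map /= coefCM coefXn.
  by case: eqVneq => [->|]; rewrite ?mulr1 ?mulr0.
have [i4|i4] := ltnP i 4.
  rewrite (bigD1 (Ordinal i4)) //= eqxx big1 ?addr0 // => j ji.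
  by rewrite ifN // eq_sym; move: ji; rewrite -val_eqE.
rewrite big1 => [|j _]; last by rewrite ifN // gtn_eqF // (leq_trans _ i4).
rewrite (_ : F^`N(i) = 0) ?horner0 //; apply/polyP => j.
rewrite coef_nderivn coef0 nth_default ?mul0rn // size_cubic_poly.
exact: leq_trans i4 (leq_addr _ _).
Qed.

End SqrtBranch.

(** * Changes of coordinates on the biquadratic curve *)

Section Moves.
Context {K : numClosedFieldType}.
Implicit Types A B : 'M[K]_3.

Lemma biformE A x0 x1 y0 y1 : biform A x0 x1 y0 y1 =
  (coef A 0 0 * y1 ^+ 2 + coef A 0 1 * y0 * y1 + coef A 0 2 * y0 ^+ 2) * x1 ^+ 2
  + (coef A 1 0 * y1 ^+ 2 + coef A 1 1 * y0 * y1 + coef A 1 2 * y0 ^+ 2) * x0 * x1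
  + (coef A 2 0 * y1 ^+ 2 + coef A 2 1 * y0 * y1 + coef A 2 2 * y0 ^+ 2) * x0 ^+ 2.
Proof. by rewrite /biform !big_ord_recr !big_ord0 /=; ring. Qed.

Lemma biform_dx0E A x0 x1 y0 y1 : biform_dx0 A x0 x1 y0 y1 =
  (coef A 1 0 * y1 ^+ 2 + coef A 1 1 * y0 * y1 + coef A 1 2 * y0 ^+ 2) * x1
  + 2%:R * (coef A 2 0 * y1 ^+ 2 + coef A 2 1 * y0 * y1 + coef A 2 2 * y0 ^+ 2) * x0.
Proof. by rewrite /biform_dx0 !big_ord_recr !big_ord0 /=; ring. Qed.

Lemma biform_dx1E A x0 x1 y0 y1 : biform_dx1 A x0 x1 y0 y1 =
  2%:R * (coef A 0 0 * y1 ^+ 2 + coef A 0 1 * y0 * y1 + coef A 0 2 * y0 ^+ 2) * x1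
  + (coef A 1 0 * y1 ^+ 2 + coef A 1 1 * y0 * y1 + coef A 1 2 * y0 ^+ 2) * x0.
Proof. by rewrite /biform_dx1 !big_ord_recr !big_ord0 /= subn0 subn1 subnn /=; ring. Qed.

Lemma biform_dy0E A x0 x1 y0 y1 : biform_dy0 A x0 x1 y0 y1 =
  (coef A 0 1 * x1 ^+ 2 + coef A 1 1 * x0 * x1 + coef A 2 1 * x0 ^+ 2) * y1
  + 2%:R * (coef A 0 2 * x1 ^+ 2 + coef A 1 2 * x0 * x1 + coef A 2 2 * x0 ^+ 2) * y0.
Proof. by rewrite /biform_dy0 !big_ord_recr !big_ord0 /=; ring. Qed.

Lemma biform_dy1E A x0 x1 y0 y1 : biform_dy1 A x0 x1 y0 y1 =
  2%:R * (coef A 0 0 * x1 ^+ 2 + coef A 1 0 * x0 * x1 + coef A 2 0 * x0 ^+ 2) * y1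
  + (coef A 0 1 * x1 ^+ 2 + coef A 1 1 * x0 * x1 + coef A 2 1 * x0 ^+ 2) * y0.
Proof. by rewrite /biform_dy1 !big_ord_recr !big_ord0 /= subn0 subn1 subnn /=; ring. Qed.

Lemma coef_mx (f : nat -> nat -> K) i j : (i < 3)%N -> (j < 3)%N ->
  coef (\matrix_(k < 3, l < 3) f k l) i j = f i j.
Proof. by move=> i3 j3; rewrite /coef mxE !inordK. Qed.

Lemma coef_tr A i j : coef A^T i j = coef A j i.
Proof. by rewrite /coef mxE. Qed.

Lemma form_at_yE A y u0 u1 :
  \sum_(i < 3) form_at_y A y i * u0 ^+ i * u1 ^+ (2 - i)
  = biform A u0 u1 (hom0 y) (hom1 y).
Proof.
rewrite biformE /form_at_y !big_ord_recr !big_ord0 /=; ring.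
Qed.

Lemma form_at_x_tr A x : form_at_x A x = form_at_y A^T x.
Proof.
by apply/funext => j; apply: eq_bigr => i _; rewrite coef_tr.
Qed.

Lemma biform_tr A x0 x1 y0 y1 : biform A^T y0 y1 x0 x1 = biform A x0 x1 y0 y1.
Proof. by rewrite !biformE !coef_tr; ring. Qed.

(** The cross product, which vanishes exactly on equal points of P^1. *)
Definition wedge (u0 u1 : K) (p : P1 K) : K := u0 * hom1 p - u1 * hom0 p.

Lemma wedge_eq0 (p q : P1 K) : wedge (hom0 p) (hom1 p) q = 0 -> p = q.
Proof.
case: p q => [x|] [y|] //=; rewrite /wedge /= ?mulr1 ?mul1r ?mul0r ?mulr0 ?subr0.
- by move/eqP; rewrite subr_eq0 => /eqP->.
- by rewrite sub0r => /eqP; rewrite oppr_eq0 oner_eq0.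
- by move/eqP; rewrite oner_eq0.
Qed.

Lemma two_solutions_unique (q : nat -> K) p p1 p2 :
  two_solutions q p p1 -> two_solutions q p p2 -> p1 = p2.
Proof.
move=> [c c0 e] [d d0 e'].
have ee u0 u1 : c * wedge u0 u1 p * wedge u0 u1 p1 = d * wedge u0 u1 p * wedge u0 u1 p2.
  by rewrite -[LHS]e -[RHS]e'.
have self (r : P1 K) : wedge (hom0 r) (hom1 r) r = 0 by rewrite /wedge mulrC subrr.
have := ee (hom0 p1) (hom1 p1); rewrite self mulr0 => /esym/eqP.
rewrite !mulf_eq0 (negPf d0) /= => /orP[/eqP/wedge_eq0 p1p|/eqP/wedge_eq0 //].
have := ee (hom0 p2) (hom1 p2); rewrite self mulr0 => /eqP.
rewrite !mulf_eq0 (negPf c0) /= => /orP[/eqP/wedge_eq0 p2p|/eqP/wedge_eq0 //].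
by rewrite p1p p2p.
Qed.

Lemma other_solution_eq (q : nat -> K) p p' :
  two_solutions q p p' -> other_solution q p = p'.
Proof.
move=> h; apply: (two_solutions_unique _ h).
by rewrite /other_solution; case: xgetP => [p'' _ //|/(_ p')/(_ h)].
Qed.

Lemma other_solution_default (q : nat -> K) p :
  (forall p', ~ two_solutions q p p') -> other_solution q p = p.
Proof.
by move=> h; rewrite /other_solution; case: xgetP => [p'' _ /h|].
Qed.

Record sl2 := SL2 { sl_a : K; sl_b : K; sl_c : K; sl_d : K;
  sl_det : sl_a * sl_d - sl_b * sl_c = 1 }.
Implicit Types g h : sl2.

Definition lin0 g u0 u1 := sl_a g * u0 + sl_b g * u1.
Definition lin1 g u0 u1 := sl_c g * u0 + sl_d g * u1.

Program Definition sl_inv g := @SL2 (sl_d g) (- sl_b g) (- sl_c g) (sl_a g) _.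
Next Obligation. by move=> g; rewrite -(sl_det g); ring. Qed.

Program Definition sl1 := @SL2 1 0 0 1 _.
Next Obligation. by ring. Qed.

Lemma lin_invK g u0 u1 :
  lin0 g (lin0 (sl_inv g) u0 u1) (lin1 (sl_inv g) u0 u1) = u0 /\
  lin1 g (lin0 (sl_inv g) u0 u1) (lin1 (sl_inv g) u0 u1) = u1.
Proof.
case: g => a b c d e; rewrite /lin0 /lin1 /=; split.
  have -> : a * (d * u0 + - b * u1) + b * (- c * u0 + a * u1) = (a * d - b * c) * u0 by ring.
  by rewrite e mul1r.
have -> : c * (d * u0 + - b * u1) + d * (- c * u0 + a * u1) = (a * d - b * c) * u1 by ring.
by rewrite e mul1r.
Qed.

Definition mobius g (p : P1 K) : P1 K :=
  if lin1 g (hom0 p) (hom1 p) == 0 then None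
  else Some (lin0 g (hom0 p) (hom1 p) / lin1 g (hom0 p) (hom1 p)).

Lemma mobiusP g p : exists2 l, l != 0 &
  lin0 g (hom0 p) (hom1 p) = l * hom0 (mobius g p) /\
  lin1 g (hom0 p) (hom1 p) = l * hom1 (mobius g p).
Proof.
rewrite /mobius; case: eqP => [u1|/eqP u1]; last first.
  by exists (lin1 g (hom0 p) (hom1 p)) => //=; rewrite mulrC divfK // mulr1.
exists (lin0 g (hom0 p) (hom1 p)); last by rewrite /= mulr1 mulr0.
apply/eqP => u0; move: u0 u1; rewrite /lin0 /lin1.
case: g => a b c d e /=; case: p => [x|] /=; rewrite ?mulr1 ?mulr0 ?addr0 => e0 e1.
  have : a * d - b * c = 0.
    have bE : b = - (a * x) by apply/eqP; rewrite -addr_eq0 addrC e0.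
    have dE : d = - (c * x) by apply/eqP; rewrite -addr_eq0 addrC e1.
    by rewrite bE dE; ring.
  by rewrite e => /eqP; rewrite oner_eq0.
by have := e; rewrite e0 e1 mulr0 mul0r subr0 => /eqP; rewrite eq_sym oner_eq0.
Qed.

Lemma wedge_mobius g u0 u1 p l :
  lin0 g (hom0 p) (hom1 p) = l * hom0 (mobius g p) ->
  lin1 g (hom0 p) (hom1 p) = l * hom1 (mobius g p) ->
  l * wedge (lin0 g u0 u1) (lin1 g u0 u1) (mobius g p) = wedge u0 u1 p.
Proof.
move=> e0 e1; rewrite /wedge mulrBr !mulrA ![l * lin0 _ _ _]mulrC ![l * lin1 _ _ _]mulrC.
rewrite -!mulrA -e0 -e1; case: g {e0 e1} => a b c d e; rewrite /lin0 /lin1 /=.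
transitivity ((a * d - b * c) * (u0 * hom1 p - u1 * hom0 p)); first by ring.
by rewrite e mul1r.
Qed.

Lemma mobius_invK g p : mobius g (mobius (sl_inv g) p) = p.
Proof.
have [l l0 [e0 e1]] := mobiusP (sl_inv g) p.
have [m m0 [f0 f1]] := mobiusP g (mobius (sl_inv g) p).
apply: wedge_eq0; have [h0 h1] := lin_invK g (hom0 p) (hom1 p).
have e : (l * m) * wedge (hom0 (mobius g (mobius (sl_inv g) p)))
   (hom1 (mobius g (mobius (sl_inv g) p))) p = 0.
  have k0 : l * m * hom0 (mobius g (mobius (sl_inv g) p)) = hom0 p.
    by rewrite -mulrA -f0 -h0 e0 e1 /lin0; ring.
  have k1 : l * m * hom1 (mobius g (mobius (sl_inv g) p)) = hom1 p.
    by rewrite -mulrA -f1 -h1 e0 e1 /lin1; ring.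
  by rewrite /wedge mulrBr !mulrA k0 k1 mulrC subrr.
by apply: (mulfI (mulf_neq0 l0 m0)); rewrite e mulr0.
Qed.

Lemma sl_invK g : mobius (sl_inv (sl_inv g)) = mobius g.
Proof. by apply/funext => p; rewrite /mobius /lin0 /lin1 /= !opprK. Qed.

Lemma mobiusK g p : mobius (sl_inv g) (mobius g p) = p.
Proof. by rewrite -{2}[g]/g -[mobius g]sl_invK mobius_invK. Qed.

Definition transforms g h A B := forall x0 x1 y0 y1,
  biform B x0 x1 y0 y1
  = biform A (lin0 g x0 x1) (lin1 g x0 x1) (lin0 h y0 y1) (lin1 h y0 y1).

Lemma transforms_inv g h A B : transforms g h A B -> transforms (sl_inv g) (sl_inv h) B A.
Proof.
by move=> e x0 x1 y0 y1; rewrite e !(lin_invK g _ _).1 !(lin_invK g _ _).2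
  !(lin_invK h _ _).1 !(lin_invK h _ _).2.
Qed.

Lemma transforms_tr g h A B : transforms g h A B -> transforms h g A^T B^T.
Proof. by move=> e x0 x1 y0 y1; rewrite !biform_tr e. Qed.

Lemma biform_scale A l m x0 x1 y0 y1 :
  biform A (l * x0) (l * x1) (m * y0) (m * y1) = l ^+ 2 * m ^+ 2 * biform A x0 x1 y0 y1.
Proof. by rewrite !biformE; ring. Qed.

Lemma transforms_curve g h A B p : transforms g h A B ->
  biquadratic_curve B p -> biquadratic_curve A (mobius g p.1, mobius h p.2).
Proof.
move=> e; rewrite /biquadratic_curve /= e.
have [l l0 [-> ->]] := mobiusP g p.1; have [m m0 [-> ->]] := mobiusP h p.2.
rewrite biform_scale => /eqP; rewrite mulf_eq0 => /orP[|/eqP //].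
by rewrite mulf_eq0 !expf_eq0 /= (negPf l0) (negPf m0).
Qed.

(** Both switches are defined by the zeros of the form on P^1, hence commute
    with changes of coordinates; the scalars that normalize homogeneous
    coordinates go into the leading constant. *)
Lemma two_solutions_transforms g h A B y p p' : transforms g h A B ->
  two_solutions (form_at_y A (mobius h y)) (mobius g p) (mobius g p') ->
  two_solutions (form_at_y B y) p p'.
Proof.
move=> e [c c0 cE].
have [l l0 [l1 l2]] := mobiusP g p; have [l' l0' [l1' l2']] := mobiusP g p'.
have [m m0 [m1 m2]] := mobiusP h y.
exists (m ^+ 2 * c / (l * l')); first by rewrite !mulf_neq0 ?invr_eq0 ?mulf_neq0 ?expf_neq0.
move=> u0 u1; rewrite form_at_yE e m1 m2.
rewrite -[X in biform _ X]mul1r -[X in biform _ _ X]mul1r biform_scale expr1n mul1r.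
rewrite -form_at_yE cE -!/(wedge _ _ _).
by rewrite -(wedge_mobius _ _ l1 l2) -(wedge_mobius _ _ l1' l2'); field; rewrite l0 l0'.
Qed.

Lemma other_solution_transforms g h A B y p : transforms g h A B ->
  other_solution (form_at_y A (mobius h y)) (mobius g p)
  = mobius g (other_solution (form_at_y B y) p).
Proof.
move=> e; have [[p' p'E]|no] := pselect (exists p', two_solutions (form_at_y B y) p p').
  rewrite (other_solution_eq p'E); apply: other_solution_eq.
  apply: (two_solutions_transforms (transforms_inv e)).
  by rewrite !mobiusK.
rewrite !other_solution_default // => p' p'E; apply: no; first by exists p'.
exists (mobius (sl_inv g) p'); apply: (two_solutions_transforms e).
by rewrite mobius_invK.
Qed.

Lemma QRT_transforms g h A B p : transforms g h A B ->
  QRT A (mobius g p.1, mobius h p.2)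
  = (mobius g (QRT B p).1, mobius h (QRT B p).2).
Proof.
move=> e; rewrite /QRT /horizontal_switch /vertical_switch /=.
by rewrite !form_at_x_tr (other_solution_transforms _ _ e)
  (other_solution_transforms _ _ (transforms_tr e)).
Qed.

(** Polarization expresses the partial derivatives by values of the form, which
    makes smoothness independent of coordinates. *)
Lemma polar_x A x0 x1 u0 u1 y0 y1 :
  u0 * biform_dx0 A x0 x1 y0 y1 + u1 * biform_dx1 A x0 x1 y0 y1
  = biform A (x0 + u0) (x1 + u1) y0 y1 - biform A x0 x1 y0 y1 - biform A u0 u1 y0 y1.
Proof. by rewrite !biformE biform_dx0E biform_dx1E; ring. Qed.

Lemma biform_dx0_tr A x0 x1 y0 y1 : biform_dx0 A^T y0 y1 x0 x1 = biform_dy0 A x0 x1 y0 y1.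
Proof. by rewrite biform_dx0E biform_dy0E !coef_tr; ring. Qed.

Lemma biform_dx1_tr A x0 x1 y0 y1 : biform_dx1 A^T y0 y1 x0 x1 = biform_dy1 A x0 x1 y0 y1.
Proof. by rewrite biform_dx1E biform_dy1E !coef_tr; ring. Qed.

Lemma lin0D g x0 x1 u0 u1 : lin0 g (x0 + u0) (x1 + u1) = lin0 g x0 x1 + lin0 g u0 u1.
Proof. by rewrite /lin0; ring. Qed.

Lemma lin1D g x0 x1 u0 u1 : lin1 g (x0 + u0) (x1 + u1) = lin1 g x0 x1 + lin1 g u0 u1.
Proof. by rewrite /lin1; ring. Qed.

Lemma transforms_dx g h A B p q : transforms g h A B ->
  biform_dx0 B (hom0 p) (hom1 p) (hom0 q) (hom1 q) = 0 ->
  biform_dx1 B (hom0 p) (hom1 p) (hom0 q) (hom1 q) = 0 ->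
  biform_dx0 A (hom0 (mobius g p)) (hom1 (mobius g p)) (hom0 (mobius h q)) (hom1 (mobius h q)) = 0 /\
  biform_dx1 A (hom0 (mobius g p)) (hom1 (mobius g p)) (hom0 (mobius h q)) (hom1 (mobius h q)) = 0.
Proof.
move=> e d0 d1.
have [l l0 [l1 l2]] := mobiusP g p; have [m m0 [m1 m2]] := mobiusP h q.
set X0 := hom0 (mobius g p) in l1 *; set X1 := hom1 (mobius g p) in l2 *.
set Y0 := hom0 (mobius h q) in m1 *; set Y1 := hom1 (mobius h q) in m2 *.
have key u0 u1 : lin0 g u0 u1 * biform_dx0 A X0 X1 Y0 Y1
    + lin1 g u0 u1 * biform_dx1 A X0 X1 Y0 Y1 = 0.
  have := polar_x B (hom0 p) (hom1 p) u0 u1 (hom0 q) (hom1 q).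
  rewrite d0 d1 !mulr0 addr0 !e lin0D lin1D -polar_x l1 l2 m1 m2 => /esym h0.
  have lm : l * m ^+ 2 != 0 by rewrite mulf_neq0 ?expf_neq0.
  by apply: (mulfI lm); rewrite mulr0 -{}h0 !biform_dx0E !biform_dx1E; ring.
have [i0 i1] := lin_invK g 1 0; have [j0 j1] := lin_invK g 0 1.
split.
  by have := key (lin0 (sl_inv g) 1 0) (lin1 (sl_inv g) 1 0); rewrite i0 i1 mul1r mul0r addr0.
by have := key (lin0 (sl_inv g) 0 1) (lin1 (sl_inv g) 0 1); rewrite j0 j1 mul1r mul0r add0r.
Qed.

Lemma smooth_transforms g h A B :
  transforms g h A B -> smooth_biquadratic A -> smooth_biquadratic B.
Proof.
move=> e smA p pB [dx0 dx1 dy0 dy1].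
have [ex0 ex1] := transforms_dx e dx0 dx1.
rewrite -biform_dx0_tr in dy0; rewrite -biform_dx1_tr in dy1.
have [ey0 ey1] := transforms_dx (transforms_tr e) dy0 dy1.
apply: (smA _ (transforms_curve e pB)); split=> //.
  by rewrite -biform_dx0_tr.
by rewrite -biform_dx1_tr.
Qed.

End Moves.

(** * Invariance of X0, Y0, D and E *)

Section Invariants.
Context {K : numClosedFieldType}.
Implicit Types (A B : 'M[K]_3) (g : @sl2 K).

(** The coefficients of f0 x1^2 + f1 x0 x1 + f2 x0^2 after the change of
    coordinates g. *)
Definition form_move g (f0 f1 f2 : K) (i : nat) : K :=
  let: (a, b, c, d) := (sl_a g, sl_b g, sl_c g, sl_d g) in
  match i with
  | 0%N => d ^+ 2 * f0 + b * d * f1 + b ^+ 2 * f2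
  | 1%N => 2%:R * c * d * f0 + (a * d + b * c) * f1 + 2%:R * a * b * f2
  | _ => c ^+ 2 * f0 + a * c * f1 + a ^+ 2 * f2
  end.

Definition move_x g A : 'M[K]_3 :=
  \matrix_(i < 3, j < 3) form_move g (coef A 0 j) (coef A 1 j) (coef A 2 j) i.

Definition move_y g A : 'M[K]_3 := (move_x g A^T)^T.

Lemma coef_move_x g A i j : (i < 3)%N -> (j < 3)%N ->
  coef (move_x g A) i j = form_move g (coef A 0 j) (coef A 1 j) (coef A 2 j) i.
Proof.
exact: (@coef_mx _ (fun i j => form_move g (coef A 0 j) (coef A 1 j) (coef A 2 j) i)).
Qed.

Lemma coef_move_y g A i j : (i < 3)%N -> (j < 3)%N ->
  coef (move_y g A) i j = form_move g (coef A i 0) (coef A i 1) (coef A i 2) j.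
Proof. by move=> i3 j3; rewrite coef_tr coef_move_x // !coef_tr. Qed.

Lemma transforms_move_x g A : transforms g (@sl1 K) A (move_x g A).
Proof.
move=> x0 x1 y0 y1; rewrite !biformE !coef_move_x // /form_move /lin0 /lin1 /=.
by ring.
Qed.

Lemma transforms_move_y g A : transforms (@sl1 K) g A (move_y g A).
Proof.
by have := transforms_tr (transforms_move_x g A^T); rewrite trmxK.
Qed.

Lemma det3E A : \det A =
    coef A 0 0 * (coef A 1 1 * coef A 2 2 - coef A 1 2 * coef A 2 1)
  - coef A 0 1 * (coef A 1 0 * coef A 2 2 - coef A 1 2 * coef A 2 0)
  + coef A 0 2 * (coef A 1 0 * coef A 2 1 - coef A 1 1 * coef A 2 0).
Proof.
have e (i j : 'I_3) : A i j = coef A i j by rewrite /coef !inord_val.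
rewrite (expand_det_row _ ord0) !big_ord_recl big_ord0 /cofactor.
rewrite !(expand_det_row _ ord0) !big_ord_recl !big_ord0 /cofactor !det_mx11 !mxE.
by rewrite !e /= /bump /=; ring.
Qed.

Lemma disc_QyE A : let c := coef A in disc_Qy A =
    (c 0%N 1%N ^+ 2 - 4%:R * c 0%N 2%N * c 0%N 0%N)%:P
  + (2%:R * c 0%N 1%N * c 1%N 1%N - 4%:R * (c 0%N 2%N * c 1%N 0%N + c 1%N 2%N * c 0%N 0%N))%:P * 'X
  + (c 1%N 1%N ^+ 2 + 2%:R * c 0%N 1%N * c 2%N 1%N
     - 4%:R * (c 0%N 2%N * c 2%N 0%N + c 1%N 2%N * c 1%N 0%N + c 2%N 2%N * c 0%N 0%N))%:P * 'X^2
  + (2%:R * c 1%N 1%N * c 2%N 1%N - 4%:R * (c 1%N 2%N * c 2%N 0%N + c 2%N 2%N * c 1%N 0%N))%:P * 'X^3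
  + (c 2%N 1%N ^+ 2 - 4%:R * c 2%N 2%N * c 2%N 0%N)%:P * 'X^4.
Proof.
have QE j : Qy_coef A j
    = (coef A 0 j)%:P + (coef A 1 j)%:P * 'X + (coef A 2 j)%:P * 'X^2.
  by rewrite /Qy_coef poly_def !big_ord_recr big_ord0 /= -!mul_polyC; ring.
by move=> c; rewrite /disc_Qy !QE /c -mul_polyC; ring.
Qed.

Definition disc_coef A (i : nat) : K := let c := coef A in match i with
  | 0%N => c 0%N 1%N ^+ 2 - 4%:R * c 0%N 2%N * c 0%N 0%N
  | 1%N => 2%:R * c 0%N 1%N * c 1%N 1%N - 4%:R * (c 0%N 2%N * c 1%N 0%N + c 1%N 2%N * c 0%N 0%N)
  | 2%N => c 1%N 1%N ^+ 2 + 2%:R * c 0%N 1%N * c 2%N 1%N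
     - 4%:R * (c 0%N 2%N * c 2%N 0%N + c 1%N 2%N * c 1%N 0%N + c 2%N 2%N * c 0%N 0%N)
  | 3%N => 2%:R * c 1%N 1%N * c 2%N 1%N - 4%:R * (c 1%N 2%N * c 2%N 0%N + c 2%N 2%N * c 1%N 0%N)
  | 4%N => c 2%N 1%N ^+ 2 - 4%:R * c 2%N 2%N * c 2%N 0%N
  | _ => 0
  end.

Lemma coef_disc_Qy A i : (i < 5)%N -> (disc_Qy A)`_i = disc_coef A i.
Proof.
move=> i5; rewrite disc_QyE !(coefD, coefCM, coefC, coefX, coefXn).
by case: i i5 => [|[|[|[|[|]]]]] //= _; ring.
Qed.

(** The Eisenstein invariants, in the coefficients of the quartic without the
    binomial factors 1, 4, 6, 4, 1. *)
Definition D_of (d0 d1 d2 d3 d4 : K) :=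
  d0 * d4 + d2 ^+ 2 / 12%:R - d1 * d3 / 4%:R.
Definition E_of (d0 d1 d2 d3 d4 : K) :=
  d0 * d3 ^+ 2 / 16%:R + d1 ^+ 2 * d4 / 16%:R - d0 * d2 * d4 / 6%:R
  - d1 * d2 * d3 / 48%:R + d2 ^+ 3 / 216%:R.

Lemma D_curveE A : D_curve A = D_of (disc_coef A 0) (disc_coef A 1)
  (disc_coef A 2) (disc_coef A 3) (disc_coef A 4).
Proof.
rewrite /D_curve /eisenstein_D /quartic_coef !coef_disc_Qy // /D_of.
rewrite (_ : 'C(4, 0) = 1%N) // (_ : 'C(4, 1) = 4%N) // (_ : 'C(4, 2) = 6%N) //.
by rewrite (_ : 'C(4, 3) = 4%N) // (_ : 'C(4, 4) = 1%N) //; field.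
Qed.

Lemma E_curveE A : E_curve A = E_of (disc_coef A 0) (disc_coef A 1)
  (disc_coef A 2) (disc_coef A 3) (disc_coef A 4).
Proof.
rewrite /E_curve /eisenstein_E /quartic_coef !coef_disc_Qy // /E_of.
rewrite (_ : 'C(4, 0) = 1%N) // (_ : 'C(4, 1) = 4%N) // (_ : 'C(4, 2) = 6%N) //.
by rewrite (_ : 'C(4, 3) = 4%N) // (_ : 'C(4, 4) = 1%N) //; field.
Qed.

Definition same_invariants A B :=
  [/\ X0 A = X0 B, Y0 A = Y0 B, D_curve A = D_curve B & E_curve A = E_curve B].

(** The coefficients of the binary quartic with coefficients d0, ..., d4 after
    the change of coordinates g. *)
Definition quartic_move g (d0 d1 d2 d3 d4 : K) (i : nat) : K :=
  let: (a, b, c, d) := (sl_a g, sl_b g, sl_c g, sl_d g) in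
  match i with
  | 0%N => d ^+ 4 * d0
     + b * d ^+ 3 * d1
     + b ^+ 2 * d ^+ 2 * d2
     + b ^+ 3 * d * d3
     + b ^+ 4 * d4
  | 1%N => 4%:R * c * d ^+ 3 * d0
     + (3%:R * b * c * d ^+ 2 + a * d ^+ 3) * d1
     + (2%:R * b ^+ 2 * c * d + 2%:R * a * b * d ^+ 2) * d2
     + (b ^+ 3 * c + 3%:R * a * b ^+ 2 * d) * d3
     + 4%:R * a * b ^+ 3 * d4
  | 2%N => 6%:R * c ^+ 2 * d ^+ 2 * d0
     + (3%:R * b * c ^+ 2 * d + 3%:R * a * c * d ^+ 2) * d1
     + (b ^+ 2 * c ^+ 2 + 4%:R * a * b * c * d + a ^+ 2 * d ^+ 2) * d2
     + (3%:R * a * b ^+ 2 * c + 3%:R * a ^+ 2 * b * d) * d3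
     + 6%:R * a ^+ 2 * b ^+ 2 * d4
  | 3%N => 4%:R * c ^+ 3 * d * d0
     + (b * c ^+ 3 + 3%:R * a * c ^+ 2 * d) * d1
     + (2%:R * a * b * c ^+ 2 + 2%:R * a ^+ 2 * c * d) * d2
     + (3%:R * a ^+ 2 * b * c + a ^+ 3 * d) * d3
     + 4%:R * a ^+ 3 * b * d4
  | 4%N => c ^+ 4 * d0
     + a * c ^+ 3 * d1
     + a ^+ 2 * c ^+ 2 * d2
     + a ^+ 3 * c * d3
     + a ^+ 4 * d4
  | _ => 0
  end.

Lemma disc_coef_move_x g A i : (i < 5)%N -> disc_coef (move_x g A) i =
  quartic_move g (disc_coef A 0) (disc_coef A 1) (disc_coef A 2) (disc_coef A 3)
    (disc_coef A 4) i.
Proof.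
case: i => [|[|[|[|[|]]]]] // _; rewrite /quartic_move /disc_coef !coef_move_x // /form_move /=; ring.
Qed.

(** The discriminant of a binary quadratic form is multiplied by the square of
    the determinant of a change of variables. *)
Lemma disc_coef_move_y g A i : disc_coef (move_y g A) i = disc_coef A i.
Proof.
have det1 (x : K) : x = (sl_a g * sl_d g - sl_b g * sl_c g) ^+ 2 * x.
  by rewrite sl_det expr1n mul1r.
rewrite [RHS]det1.
case: i => [|[|[|[|[|]]]]] /=; rewrite /disc_coef ?mulr0 // !coef_move_y // /form_move /=; ring.
Qed.

(** X0, Y0, D and E have weights 2, 3, 4 and 6 in the determinant of the change
    of x, and the factors below are powers of that determinant 1. *)
Lemma same_invariants_move_y g A : same_invariants A (move_y g A).
Proof.
have det1 n (x : K) : x = (sl_a g * sl_d g - sl_b g * sl_c g) ^+ n * x.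
  by rewrite sl_det expr1n mul1r.
split.
- by rewrite (det1 2%N (X0 A)) /X0 !coef_move_y // /form_move /=; field.
- by rewrite (det1 3%N (Y0 A)) /Y0 !det3E !coef_move_y // /form_move /=; ring.
- by rewrite !D_curveE !disc_coef_move_y.
- by rewrite !E_curveE !disc_coef_move_y.
Qed.

Lemma same_invariants_move_x g A : same_invariants A (move_x g A).
Proof.
have det1 n (x : K) : x = (sl_a g * sl_d g - sl_b g * sl_c g) ^+ n * x.
  by rewrite sl_det expr1n mul1r.
split.
- by rewrite (det1 2%N (X0 A)) /X0 !coef_move_x // /form_move /=; field.
- by rewrite (det1 3%N (Y0 A)) /Y0 !det3E !coef_move_x // /form_move /=; ring.
- rewrite !D_curveE !disc_coef_move_x // (det1 4%N (D_of _ _ _ _ _)).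
  move: (disc_coef A 0) (disc_coef A 1) (disc_coef A 2) (disc_coef A 3) (disc_coef A 4).
  by move=> d0 d1 d2 d3 d4; rewrite /D_of /quartic_move; field.
- rewrite !E_curveE !disc_coef_move_x // (det1 6%N (E_of _ _ _ _ _)).
  move: (disc_coef A 0) (disc_coef A 1) (disc_coef A 2) (disc_coef A 3) (disc_coef A 4).
  by move=> d0 d1 d2 d3 d4; rewrite /E_of /quartic_move; field.
Qed.

End Invariants.

(** * The isomorphism of the biquadratic curve with the cubic *)

Section Model.
Context {K : numClosedFieldType}.
Implicit Types (A B : 'M[K]_3) (p : P1 K * P1 K).

(** Injectivity and a point over infinity are enough to carry periods from one
    curve to the other. *)
Definition translation_model A : Prop :=
  [/\ nonsingular (D_curve A) (E_curve A), Gamma_curve A (Some (X0 A, Y0 A))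
    & exists Phi : P1 K * P1 K -> option (K * K),
      [/\ forall p, biquadratic_curve A p -> Gamma_curve A (Phi p),
          forall p p', biquadratic_curve A p -> biquadratic_curve A p' ->
            Phi p = Phi p' -> p = p',
          forall p, biquadratic_curve A p -> biquadratic_curve A (QRT A p) /\
            Phi (QRT A p) = translation A (Phi p)
        & exists2 p, biquadratic_curve A p & Phi p = None]].

Lemma translation_model_transforms g h A B : transforms g h A B ->
  same_invariants A B -> translation_model B -> translation_model A.
Proof.
move=> e [eX eY eD eE] [ns P0 [Phi [PhiC Phi_inj PhiT [b bC b0]]]].
have TE : translation A = translation B by rewrite /translation eX eY eD.
have GE : Gamma_curve A = Gamma_curve B by rewrite /Gamma_curve eD eE.
rewrite /translation_model eX eY eD eE GE TE; split=> //.
pose s (p : P1 K * P1 K) := (mobius g p.1, mobius h p.2).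
pose t (p : P1 K * P1 K) := (mobius (sl_inv g) p.1, mobius (sl_inv h) p.2).
have stK p : s (t p) = p by case: p => [x y]; rewrite /s /t /= !mobius_invK.
have tsK p : t (s p) = p by case: p => [x y]; rewrite /s /t /= !mobiusK.
have tC p : biquadratic_curve A p -> biquadratic_curve B (t p).
  exact: transforms_curve (transforms_inv e).
have sC p : biquadratic_curve B p -> biquadratic_curve A (s p).
  exact: transforms_curve e.
have tQ p : t (QRT A p) = QRT B (t p).
  by rewrite -{1}[p]stK -[t p]tsK /s (QRT_transforms _ e) -/(s _) !tsK.
exists (Phi \o t); split=> /=.
- by move=> p /tC; exact: PhiC.
- by move=> p p' /tC pC /tC p'C /(Phi_inj _ _ pC p'C) /(congr1 s); rewrite !stK.
- move=> p /tC pC; have [QC QE] := PhiT _ pC; rewrite tQ; split=> //.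
  by rewrite -[QRT A p]stK tQ; exact: sC.
- by exists (s b); [exact: sC | rewrite tsK].
Qed.

Lemma biquadratic_curveE A x y : biquadratic_curve A (x, y) <->
  biform A (hom0 x) (hom1 x) (hom0 y) (hom1 y) = 0.
Proof. by []. Qed.

Lemma other_solution_form_at_y A (y p p' : P1 K) (c : K) : c != 0 ->
  (forall u0 u1, biform A u0 u1 (hom0 y) (hom1 y) = c * wedge u0 u1 p * wedge u0 u1 p') ->
  other_solution (form_at_y A y) p = p'.
Proof.
move=> c0 e; apply: other_solution_eq; exists c => // u0 u1.
by rewrite form_at_yE e.
Qed.

Lemma other_solution_form_at_x A (x p p' : P1 K) (c : K) : c != 0 ->
  (forall v0 v1, biform A (hom0 x) (hom1 x) v0 v1 = c * wedge v0 v1 p * wedge v0 v1 p') ->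
  other_solution (form_at_x A x) p = p'.
Proof.
move=> c0 e; rewrite form_at_x_tr; apply: (other_solution_form_at_y c0) => u0 u1.
by rewrite biform_tr.
Qed.

(** In the coordinates below, Q = q x^2 + (p y^2 + r y + s) x + (t y + u). The
    points over x = oo coincide in (oo, oo), so that the discriminant in y has
    degree 3, and the points over y = oo are (oo, oo) and (0, oo). *)
Section NormalForm.
Variable A : 'M[K]_3.
Hypotheses (A22 : coef A 2 2 = 0) (A21 : coef A 2 1 = 0) (A02 : coef A 0 2 = 0).
Hypothesis smA : smooth_biquadratic A.

Local Notation p := (coef A 1 2).
Local Notation q := (coef A 2 0).
Local Notation r := (coef A 1 1).
Local Notation s := (coef A 1 0).
Local Notation t := (coef A 0 1).
Local Notation u := (coef A 0 0).

Let c2 : 2%:R != 0 :> K. Proof. by rewrite pnatr_eq0. Qed.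

Lemma normal_biform x0 x1 y0 y1 : biform A x0 x1 y0 y1 =
  q * x0 ^+ 2 * y1 ^+ 2 + (p * y0 ^+ 2 + r * y0 * y1 + s * y1 ^+ 2) * x0 * x1
  + (t * y0 + u * y1) * y1 * x1 ^+ 2.
Proof. by rewrite biformE A22 A21 A02; ring. Qed.

Lemma normal_p_neq0 : p != 0.
Proof.
apply/eqP => p0; apply: (smA (p := (None, None))).
  by rewrite /biquadratic_curve /= normal_biform p0; ring.
by rewrite /= biform_dx0E biform_dx1E biform_dy0E biform_dy1E A22 A21 A02 p0; split; ring.
Qed.

Lemma quadratic_root (a b c : K) : a != 0 -> exists x, a * x ^+ 2 + b * x + c = 0.
Proof.
move=> a0; have := @solve_monicpoly K 2 (fun i => nth 0 [:: - c / a; - b / a] i) isT.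
move=> [x xE]; exists x; move: xE; rewrite !big_ord_recr big_ord0 /= => ->.
by field.
Qed.

Lemma normal_q_neq0 : q != 0.
Proof.
apply/eqP => q0; have [y yE] := quadratic_root r s normal_p_neq0.
apply: (smA (p := (None, Some y))).
  by rewrite /biquadratic_curve /= normal_biform q0; ring.
rewrite /= biform_dx0E biform_dx1E biform_dy0E biform_dy1E A22 A21 A02 q0; split; try by ring.
by rewrite -[RHS]yE; ring.
Qed.

Definition normal_disc (x : K) := (r * x + t) ^+ 2 - 4%:R * p * x * (q * x ^+ 2 + s * x + u).
Definition normal_disc' (x : K) := 2%:R * r * (r * x + t)
  - 4%:R * p * (3%:R * q * x ^+ 2 + 2%:R * s * x + u).

Lemma normal_X0 : X0 A = (r ^+ 2 - 4%:R * p * s) / 12%:R.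
Proof. by rewrite /X0 A22 A21 A02; field. Qed.

Lemma normal_Y0 : Y0 A = p * q * t.
Proof. by rewrite /Y0 det3E A22 A21 A02; ring. Qed.

Lemma normal_D : D_curve A = (r ^+ 2 - 4%:R * p * s) ^+ 2 / 12%:R
  + p * q * (2%:R * r * t - 4%:R * p * u).
Proof. by rewrite D_curveE /D_of /disc_coef A22 A21 A02; field. Qed.

Lemma normal_cubic_rhs x :
  cubic_rhs (D_curve A) (E_curve A) (X0 A - p * q * x) = (p * q) ^+ 2 * normal_disc x.
Proof.
rewrite /cubic_rhs normal_X0 normal_D E_curveE /E_of /disc_coef A22 A21 A02 /normal_disc.
by field.
Qed.

Lemma normal_cubic_deriv x :
  12%:R * (X0 A - p * q * x) ^+ 2 - D_curve A = - (p * q) * normal_disc' x.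
Proof. by rewrite normal_X0 normal_D /normal_disc'; field. Qed.

(** A double root x of the discriminant gives a singular point: the double
    root y of Q(x, .) or, when Q(x, .) vanishes, a root of the x-derivative. *)
Lemma normal_disc_simple x : normal_disc x = 0 -> normal_disc' x != 0.
Proof.
move=> d0; apply/eqP => d'0; have p0 := normal_p_neq0.
have [x0|xN0] := eqVneq x 0.
  have t0 : t = 0.
    have : t ^+ 2 = 0 by rewrite -d0 /normal_disc x0; ring.
    by move/eqP; rewrite expf_eq0 => /eqP.
  have u0 : u = 0.
    have : 4%:R * p * u = 0 by rewrite -[RHS]oppr0 -d'0 /normal_disc' x0 t0; ring.
    by move/eqP; rewrite !mulf_eq0 pnatr_eq0 (negPf p0) /= => /eqP.
  have [y yE] := quadratic_root r s p0.
  apply: (smA (p := (Some 0, Some y))).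
    by rewrite /biquadratic_curve /= normal_biform t0 u0; ring.
  rewrite /= biform_dx0E biform_dx1E biform_dy0E biform_dy1E A22 A21 A02 t0 u0; split; try by ring.
  by rewrite -[RHS]yE; ring.
pose y := - (r * x + t) / (2%:R * p * x).
have pxN0 : p * x != 0 by rewrite mulf_neq0.
have Q0 : q * x ^+ 2 + (p * y ^+ 2 + r * y + s) * x + (t * y + u) = 0.
  transitivity (- normal_disc x / (4%:R * p * x)); last by rewrite d0 oppr0 mul0r.
  by rewrite /normal_disc /y; field; rewrite p0 xN0.
have Qx0 : 2%:R * q * x + (p * y ^+ 2 + r * y + s) = 0.
  transitivity ((p * normal_disc x - p * x * normal_disc' x) / (4%:R * p ^+ 2 * x ^+ 2)).
    by rewrite /normal_disc /normal_disc' /y; field; rewrite p0 xN0.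
  by rewrite d0 d'0 !mulr0 subr0 mul0r.
have Qy0 : 2%:R * p * x * y + r * x + t = 0 by rewrite /y; field; rewrite p0 xN0.
apply: (smA (p := (Some x, Some y))).
  by rewrite /biquadratic_curve /= normal_biform -[RHS]Q0; ring.
rewrite /= biform_dx0E biform_dx1E biform_dy0E biform_dy1E A22 A21 A02; split.
- by rewrite -[RHS]Qx0; ring.
- transitivity (2%:R * (q * x ^+ 2 + (p * y ^+ 2 + r * y + s) * x + (t * y + u))
    - x * (2%:R * q * x + (p * y ^+ 2 + r * y + s))); first by ring.
  by rewrite Q0 Qx0; ring.
- by rewrite -[RHS]Qy0; ring.
- transitivity (2%:R * (q * x ^+ 2 + (p * y ^+ 2 + r * y + s) * x + (t * y + u))
    - y * (2%:R * p * x * y + r * x + t)); first by ring.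
  by rewrite Q0 Qy0; ring.
Qed.

Lemma normal_t0_u : t = 0 -> u != 0.
Proof.
move=> t0; have := @normal_disc_simple 0.
rewrite /normal_disc /normal_disc' t0 => /(_ ltac:(ring)).
by apply: contra => /eqP ->; apply/eqP; ring.
Qed.

Definition normal_eq (x y : K) := q * x ^+ 2 + (p * y ^+ 2 + r * y + s) * x + (t * y + u).

Lemma normal_curveP z : biquadratic_curve A z <->
  match z with
  | (Some x, Some y) => normal_eq x y = 0
  | (Some x, None) => x = 0
  | (None, Some _) => False
  | (None, None) => True
  end.
Proof.
have q0 := normal_q_neq0; have p0 := normal_p_neq0.
case: z => [[x|] [y|]]; rewrite biquadratic_curveE normal_biform /= /normal_eq.
- by match goal with |- ?l = 0 <-> ?e = 0 => have -> : l = e by ring end.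
- match goal with |- ?l = 0 <-> _ => have -> : l = p * x by ring end.
  by split=> [/eqP|->]; [rewrite mulf_eq0 (negPf p0) => /eqP | rewrite mulr0].
- by split=> // e; case/eqP: q0; rewrite -[RHS]e; ring.
- by split=> // _; ring.
Qed.

(** The isomorphism with the cubic. The discriminant of Q with respect to y has
    degree 3, so that (x, 2 a(x) y + b(x)) is a point of the cubic curve
    w^2 = normal_disc x, which is a rescaling of Gamma. *)
Definition normal_map (z : P1 K * P1 K) : option (K * K) :=
  match z with
  | (Some x, Some y) => Some (X0 A - p * q * x, p * q * (2%:R * p * x * y + r * x + t))
  | (Some x, None) => Some (X0 A - p * q * x, - (p * q * (r * x + t)))
  | (None, _) => None
  end.

Lemma normal_map_mem z : biquadratic_curve A z -> Gamma_curve A (normal_map z).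
Proof.
move=> /normal_curveP; rewrite /Gamma_curve; case: z => [[x|] [y|]] //= zE.
  rewrite normal_cubic_rhs /normal_disc.
  have uE : u = - (q * x ^+ 2 + (p * y ^+ 2 + r * y + s) * x + t * y).
    by apply/eqP; rewrite -addr_eq0 -zE /normal_eq; apply/eqP; ring.
  by rewrite uE; ring.
by rewrite normal_cubic_rhs /normal_disc zE; ring.
Qed.

Lemma normal_map_inj z z' : biquadratic_curve A z -> biquadratic_curve A z' ->
  normal_map z = normal_map z' -> z = z'.
Proof.
have q0 := normal_q_neq0; have p0 := normal_p_neq0.
have pq0 : p * q != 0 by rewrite mulf_neq0.
have Xinj (x x' : K) : X0 A - p * q * x = X0 A - p * q * x' -> x = x'.
  by move/addrI/oppr_inj/(mulfI pq0).
have at0 y : normal_eq 0 y = 0 -> t != 0 /\ t * y + u = 0.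
  rewrite /normal_eq => e; have tyu : t * y + u = 0 by rewrite -[RHS]e; ring.
  split=> //; apply/eqP => t0; have := normal_t0_u t0.
  by rewrite -tyu t0 mul0r add0r eqxx.
have neg_t (y : K) : p * q * (2%:R * p * 0 * y + r * 0 + t) = - (p * q * (r * 0 + t)) -> t = 0.
  move=> e; have : 2%:R * (p * q) * t = 0.
    transitivity (p * q * (2%:R * p * 0 * y + r * 0 + t) + p * q * (r * 0 + t)); first by ring.
    by rewrite e addNr.
  by move/eqP; rewrite mulf_eq0 mulf_eq0 (negPf c2) (negPf pq0) => /eqP.
move=> /normal_curveP + /normal_curveP; case: z z' => [[x|] [y|]] [[x'|] [y'|]] //=.
- move=> e e' [/Xinj xx']; rewrite -{}xx' in e' * => /(mulfI pq0)/addIr/addIr.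
  have [x0|xN0] := eqVneq x 0; last first.
    by move/mulfI => -> //; rewrite !mulf_neq0.
  rewrite x0 in e e' *; have [t0 ty] := at0 _ e; have [_ ty'] := at0 _ e'.
  by move=> _; congr (_, Some _); apply: (mulfI t0); apply: (addIr u); rewrite ty ty'.
- move=> e x'0 [/Xinj xx']; rewrite x'0 in xx' *; rewrite xx' in e *.
  by move=> /neg_t t0; have [] := at0 _ e; rewrite t0 eqxx.
- move=> x0 e' [/Xinj xx']; rewrite x0 in xx' *; rewrite -xx' in e' *.
  by move=> /esym/neg_t t0; have [] := at0 _ e'; rewrite t0 eqxx.
- by move=> -> ->.
Qed.

Lemma horizontal_affine x y : normal_eq x y = 0 ->
  other_solution (form_at_y A (Some y)) (Some x)
  = Some (- (p * y ^+ 2 + r * y + s) / q - x).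
Proof.
have q0 := normal_q_neq0; move=> e; apply: (other_solution_form_at_y q0) => u0 u1.
rewrite normal_biform /wedge /=.
have uE : u = - (q * x ^+ 2 + (p * y ^+ 2 + r * y + s) * x + t * y).
  by apply/eqP; rewrite -addr_eq0 -e /normal_eq; apply/eqP; ring.
by rewrite uE; field.
Qed.

Lemma horizontal_oo : other_solution (form_at_y A None) None = Some 0.
Proof.
have pN : - p != 0 by rewrite oppr_eq0 normal_p_neq0.
by apply: (other_solution_form_at_y pN) => u0 u1; rewrite normal_biform /wedge /=; ring.
Qed.

Lemma horizontal_0 : other_solution (form_at_y A None) (Some 0) = None.
Proof.
have pN : - p != 0 by rewrite oppr_eq0 normal_p_neq0.
by apply: (other_solution_form_at_y pN) => u0 u1; rewrite normal_biform /wedge /=; ring.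
Qed.

Lemma vertical_affine x y : x != 0 -> normal_eq x y = 0 ->
  other_solution (form_at_x A (Some x)) (Some y) = Some (- (r * x + t) / (p * x) - y).
Proof.
have p0 := normal_p_neq0; move=> x0 e; have px0 : p * x != 0 by rewrite mulf_neq0.
apply: (other_solution_form_at_x px0) => v0 v1; rewrite normal_biform /wedge /=.
have uE : u = - (q * x ^+ 2 + (p * y ^+ 2 + r * y + s) * x + t * y).
  by apply/eqP; rewrite -addr_eq0 -e /normal_eq; apply/eqP; ring.
by rewrite uE; field; rewrite p0 x0.
Qed.

Lemma vertical_0_oo : other_solution (form_at_x A (Some 0)) None
  = if t == 0 then None else Some (- u / t).
Proof.
have [t0|t0] := eqVneq t 0.
  apply: (other_solution_form_at_x (normal_t0_u t0)) => v0 v1.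
  by rewrite normal_biform /wedge /= t0; ring.
have tN : - t != 0 by rewrite oppr_eq0.
apply: (other_solution_form_at_x tN) => v0 v1.
by rewrite normal_biform /wedge /=; field.
Qed.

Lemma vertical_0_affine : t != 0 ->
  other_solution (form_at_x A (Some 0)) (Some (- u / t)) = None.
Proof.
move=> t0; have tN : - t != 0 by rewrite oppr_eq0.
apply: (other_solution_form_at_x tN) => v0 v1.
by rewrite normal_biform /wedge /=; field.
Qed.

Lemma vertical_oo : other_solution (form_at_x A None) None = None.
Proof.
apply: (other_solution_form_at_x normal_q_neq0) => v0 v1.
by rewrite normal_biform /wedge /=; ring.
Qed.

(** On a horizontal line, w = 2 p x y + r x + t is an affine function of x with
    value t at x = 0. So the images of (x, y) and (x', y) are on a line of slope
    - (2 p y + r) through [X0 : Y0 : 1], and the sum is the image of (x', y) with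
    the sign of w changed, as by the vertical switch. *)
Lemma normal_translation x y : normal_eq x y = 0 ->
  let x' := - (p * y ^+ 2 + r * y + s) / q - x in
  translation A (normal_map (Some x, Some y))
  = Some (X0 A - p * q * x', - (p * q * (2%:R * p * x' * y + r * x' + t))).
Proof.
have q0 := normal_q_neq0; have p0 := normal_p_neq0.
have pq0 : p * q != 0 by rewrite mulf_neq0.
move=> e x'; rewrite /translation /cubic_add /=.
set X1 := X0 A - p * q * x; set Y1 := p * q * _.
have XE : (X1 == X0 A) = (x == 0).
  by rewrite /X1 -subr_eq0 addrAC subrr add0r oppr_eq0 mulf_eq0 (negPf pq0).
have slope : (if X1 == X0 A then (12%:R * X1 ^+ 2 - D_curve A) / (2%:R * Y1)
              else (Y0 A - Y1) / (X0 A - X1)) = - (2%:R * p * y + r).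
  rewrite XE; case: eqVneq => [x0|xN0].
    have tyu : t * y + u = 0 by rewrite -[RHS]e /normal_eq x0; ring.
    have t0 : t != 0.
      by apply/eqP => t0; have := normal_t0_u t0; rewrite -tyu t0 mul0r add0r eqxx.
    have yE : y = - u / t.
      by apply: (mulfI t0); apply: (addIr u); rewrite tyu; field.
    rewrite /X1 normal_cubic_deriv /normal_disc' /Y1 x0 yE.
    by field; rewrite t0 p0 q0.
  have -> : X0 A - X1 = p * q * x by rewrite /X1; ring.
  by rewrite /Y1 normal_Y0; field; rewrite q0 p0 xN0.
rewrite slope XE.
have -> : (x == 0) && (Y1 == - Y0 A) = false.
  apply/negP => /andP[/eqP x0 /eqP]; rewrite /Y1 normal_Y0 x0 => e1.
  have tyu : t * y + u = 0 by rewrite -[RHS]e /normal_eq x0; ring.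
  have : 2%:R * (p * q) * t = 0.
    transitivity (p * q * (2%:R * p * 0 * y + r * 0 + t) + p * q * t); first by ring.
    by rewrite e1 addNr.
  move/eqP; rewrite mulf_eq0 mulf_eq0 (negPf c2) (negPf pq0) /= => /eqP t0.
  by have := normal_t0_u t0; rewrite -tyu t0 mul0r add0r eqxx.
congr (Some (_, _)); last first.
  have -> : (- (2%:R * p * y + r)) ^+ 2 / 4%:R - X1 - X0 A = X0 A - p * q * x'.
    by rewrite /X1 /x' normal_X0; field.
  by rewrite /Y1 /X1 /x'; field.
by rewrite /X1 /x' normal_X0; field.
Qed.

Lemma normal_QRT z : biquadratic_curve A z ->
  biquadratic_curve A (QRT A z) /\ normal_map (QRT A z) = translation A (normal_map z).
Proof.
have q0 := normal_q_neq0; have p0 := normal_p_neq0.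
have pq0 : p * q != 0 by rewrite mulf_neq0.
move=> /normal_curveP; rewrite /QRT /vertical_switch /horizontal_switch.
case: z => [[x|] [y|]] // zE.
- rewrite normal_translation // /comp /= horizontal_affine //.
  set x' := _ - x; have e' : normal_eq x' y = 0.
    have uE : u = - (q * x ^+ 2 + (p * y ^+ 2 + r * y + s) * x + t * y).
      by apply/eqP; rewrite -addr_eq0 -zE /normal_eq; apply/eqP; ring.
    by rewrite /normal_eq uE /x'; field.
  have [x'0|x'N0] := eqVneq x' 0.
    rewrite x'0 in e' *.
    have tyu : t * y + u = 0 by rewrite -[RHS]e' /normal_eq; ring.
    have t0 : t != 0.
      by apply/eqP => t0; have := normal_t0_u t0; rewrite -tyu t0 mul0r add0r eqxx.
    have -> : y = - u / t.
      by apply: (mulfI t0); apply: (addIr u); rewrite tyu; field.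
    rewrite vertical_0_affine //; split; first exact/normal_curveP.
    by rewrite /=; congr (Some (_, _)); ring.
  rewrite vertical_affine //; split.
    apply/normal_curveP.
    have uE : u = - (q * x' ^+ 2 + (p * y ^+ 2 + r * y + s) * x' + t * y).
      by apply/eqP; rewrite -addr_eq0 -e' /normal_eq; apply/eqP; ring.
    by rewrite /normal_eq uE; clearbody x'; field; rewrite p0 x'N0.
  by rewrite /=; congr (Some (_, _)); clearbody x'; field; rewrite p0 x'N0.
- rewrite zE /= horizontal_0 vertical_oo; split; first exact/normal_curveP.
  rewrite /= /translation /cubic_add mulr0 subr0 eqxx normal_Y0 /=.
  by rewrite mulr0 add0r eqxx.
- rewrite /= horizontal_oo vertical_0_oo /translation /=.
  have [t0|t0] := eqVneq t 0; split; try exact/normal_curveP.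
  + by rewrite /= normal_Y0 t0; congr (Some (_, _)); ring.
  + by apply/normal_curveP; rewrite /normal_eq; field.
  + by rewrite /= normal_Y0; congr (Some (_, _)); ring.
Qed.

Lemma normal_model : translation_model A.
Proof.
have q0 := normal_q_neq0; have p0 := normal_p_neq0.
have pq0 : p * q != 0 by rewrite mulf_neq0.
split.
- move=> X; have -> : X = X0 A - p * q * ((X0 A - X) / (p * q)).
    by field; rewrite q0 p0.
  rewrite normal_cubic_rhs normal_cubic_deriv => /eqP.
  rewrite mulf_eq0 expf_eq0 (negPf pq0) /= => /eqP/normal_disc_simple d'.
  by rewrite mulf_neq0 // oppr_eq0.
- have -> : X0 A = X0 A - p * q * 0 by rewrite mulr0 subr0.
  rewrite /Gamma_curve /= normal_cubic_rhs normal_Y0 /normal_disc; ring.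
exists normal_map; split.
- exact: normal_map_mem.
- exact: normal_map_inj.
- exact: normal_QRT.
- by exists (None, None); first exact/normal_curveP.
Qed.

End NormalForm.

(** Coordinates in which a ramification point of the first projection is at
    infinity in both factors, and the other point over y = oo is at x = 0. *)
Lemma smooth_translation_model A : smooth_biquadratic A -> translation_model A.
Proof.
have step_x g B : (smooth_biquadratic (move_x g B) -> translation_model (move_x g B)) ->
    smooth_biquadratic B -> translation_model B.
  move=> H smB; apply: (translation_model_transforms (transforms_move_x g B)).
    exact: same_invariants_move_x.
  exact/H/(smooth_transforms (transforms_move_x g B)).
have step_y g B : (smooth_biquadratic (move_y g B) -> translation_model (move_y g B)) ->
    smooth_biquadratic B -> translation_model B.
  move=> H smB; apply: (translation_model_transforms (transforms_move_y g B)).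
    exact: same_invariants_move_y.
  exact/H/(smooth_transforms (transforms_move_y g B)).
have step3 B : coef B 2 2 = 0 -> coef B 2 1 = 0 -> smooth_biquadratic B -> translation_model B.
  move=> B22 B21 smB.
  have p0 : coef B 1 2 != 0.
    apply/eqP => p0; apply: (smB (None, None)).
      by rewrite /biquadratic_curve /= biformE B22 B21 p0; ring.
    by rewrite /= biform_dx0E biform_dx1E biform_dy0E biform_dy1E B22 B21 p0; split; ring.
  (* The shift of x that moves the second point over y = oo to x = 0. *)
  have det1 : 1 * 1 - (- coef B 0 2 / coef B 1 2) * 0 = 1 by ring.
  apply: (step_x (SL2 det1)) smB => smB'.
  apply: normal_model => //; rewrite coef_move_x // /form_move /= ?B22 ?B21; try by ring.
  by field.
(* The substitution z - 1 / x for x moves z to infinity. *)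
have det_at (z : K) : z * 0 - (- 1) * 1 = 1 by ring.
have step2 B : coef B 2 1 ^+ 2 = 4%:R * coef B 2 2 * coef B 2 0 ->
    smooth_biquadratic B -> translation_model B.
  move=> d4; have [B22|B22] := eqVneq (coef B 2 2) 0.
    apply: step3 => //; move: d4; rewrite B22 mulr0 mul0r => /eqP.
    by rewrite expf_eq0 => /eqP.
  apply: (step_y (SL2 (det_at (- coef B 2 1 / (2%:R * coef B 2 2))))).
  have B20 : coef B 2 0 = coef B 2 1 ^+ 2 / (4%:R * coef B 2 2).
    by rewrite d4; field.
  by apply: step3; rewrite coef_move_y // /form_move /= ?B20; field.
have [d4|d4] := eqVneq (disc_coef A 4) 0.
  by apply: step2; apply/eqP; rewrite -subr_eq0 -[X in X == _]/(disc_coef A 4) d4.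
have [z zE] : exists z, disc_coef A 0 + disc_coef A 1 * z + disc_coef A 2 * z ^+ 2
    + disc_coef A 3 * z ^+ 3 + disc_coef A 4 * z ^+ 4 = 0.
  have := @solve_monicpoly K 4 (fun i => - disc_coef A i / disc_coef A 4) isT.
  move=> [z zE]; exists z; move: zE; rewrite !big_ord_recr big_ord0 /= => ->.
  by field.
apply: (step_x (SL2 (det_at z))); apply: step2.
apply/eqP; rewrite -subr_eq0 -[X in X == _]/(disc_coef _ 4) disc_coef_move_x //.
by rewrite -[X in _ == X]zE; apply/eqP; rewrite /quartic_move /disc_coef /=; ring.
Qed.

End Model.

(** * Periods and Hankel determinants *)

Section Criterion.
Context {R : realType}.
Implicit Types A : 'M[R[i]]_3.

Lemma n_periodic_translation A n : smooth_biquadratic A ->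
  n_periodic (Gamma_curve A) (translation A) n <-> iter n (translation A) None = None.
Proof.
move=> /smooth_translation_model[ns P0E _].
exact: n_periodic_add ns P0E n.
Qed.

(** On the curve, the orbit of the point sent to infinity decides whether an
    iterate of the translation is the identity; injectivity brings it back. *)
Lemma n_periodic_QRT A n : smooth_biquadratic A ->
  n_periodic (biquadratic_curve A) (QRT A) n <->
  n_periodic (Gamma_curve A) (translation A) n.
Proof.
move=> smA; have [_ _ [Phi [PhiC Phi_inj PhiT [b bC b0]]]] := smooth_translation_model smA.
have itP m p : biquadratic_curve A p -> biquadratic_curve A (iter m (QRT A) p) /\
    Phi (iter m (QRT A) p) = iter m (translation A) (Phi p).
  move=> pC; elim: m => [|m [IHC IHE]] //=.
  by have [QC QE] := PhiT _ IHC; rewrite QE IHE.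
split=> [perQ|perT p pC].
  apply/n_periodic_translation => //.
  by rewrite -b0 -(itP n b bC).2 (perQ _ bC).
have [itC itE] := itP n p pC; apply: Phi_inj => //.
by rewrite itE perT //; exact: PhiC.
Qed.

Lemma has_order_QRT A n : smooth_biquadratic A ->
  has_order (biquadratic_curve A) (QRT A) n <->
  has_order (Gamma_curve A) (translation A) n.
Proof.
move=> smA; split=> -[n0 per minper]; split=> //.
- exact/n_periodic_QRT.
- by move=> m mn /(n_periodic_QRT _ smA); exact: minper.
- exact/n_periodic_QRT.
- by move=> m mn /(n_periodic_QRT _ smA); exact: minper.
Qed.

Lemma not_n_periodic1 A : smooth_biquadratic A ->
  ~ n_periodic (Gamma_curve A) (translation A) 1.
Proof. by move=> smA /(n_periodic_translation _ smA). Qed.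

Lemma n_periodic2 A : smooth_biquadratic A ->
  n_periodic (Gamma_curve A) (translation A) 2 <-> Y0 A = 0.
Proof.
move=> smA; apply: (iff_trans (n_periodic_translation _ smA)).
rewrite /= /translation /cubic_add /= eqxx /=.
case: eqP => [e|ne]; split=> //.
- move=> _; have : 2%:R * Y0 A = 0 by rewrite mulr_natl mulr2n {1}e addNr.
  by move/eqP; rewrite mulf_eq0 pnatr_eq0 /= => /eqP.
- by move=> Y00; case: ne; rewrite Y00 oppr0.
Qed.

Lemma n_periodic_hankel A k m s : smooth_biquadratic A -> Y0 A != 0 ->
  (s + m = k.+2)%N -> (m == k) || (m.+1 == k) ->
  n_periodic (Gamma_curve A) (translation A) (k.+1 + m) <->
  \det (hankel (taylor_coef A) s m) = 0.
Proof.
move=> smA Y0N0 sm mk; apply: (iff_trans (n_periodic_translation _ smA)).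
have [ns P0E _] := smooth_translation_model smA.
apply: (iter_add_hankel ns P0E _ _ sm mk).
- exact: taylor_coef0.
- exact: taylor_coef_conv.
Qed.

Lemma n_periodic_cases A n : smooth_biquadratic A -> (0 < n)%N -> ((2 < n)%N -> Y0 A != 0) ->
  n_periodic (Gamma_curve A) (translation A) n <-> one_of_cases A n.
Proof.
move=> smA n0 Y0n; have [n2|n2] := ltnP 2 n; last first.
  have [n1|->] : n = 1%N \/ n = 2%N by lia.
    rewrite n1; split=> [/(not_n_periodic1 smA) //|[[//]|[k []]|[k []]]]; lia.
  apply: (iff_trans (n_periodic2 smA)); split=> [Y00|[[_ //]|[k []]|[k []]]].
  - by apply: Or31.
  - by lia.
  - by lia.
have Y0N0 := Y0n n2.
have [k [k0 [nE|nE]]] : exists k, (0 < k)%N /\ (n = k.+1 + k \/ n = k.+2 + k)%N.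
  exists n.-1./2; have := odd_double_half n.-1; rewrite -addnn.
  by case: (odd n.-1) => /=; lia.
- rewrite nE; have nP := @n_periodic_hankel A k k 2 smA Y0N0 erefl.
  rewrite eqxx in nP; apply: (iff_trans (nP isT)).
  split=> [d0|[[]|[l [l0 lE _ d0]]|[l [l0 lE]]]]; try by lia.
    by apply: Or32; exists k; split=> //; lia.
  by have -> : k = l by lia.
- rewrite nE; have nP := @n_periodic_hankel A k.+1 k 3 smA Y0N0 erefl.
  rewrite eqxx orbT in nP; apply: (iff_trans (nP isT)).
  split=> [d0|[[]|[l [l0 lE]]|[l [l0 lE _ d0]]]]; try by lia.
    by apply: Or33; exists k.+1; split=> //; lia.
  by have -> : k = l.-1 by lia.
Qed.

Lemma has_order_cases A n : smooth_biquadratic A -> (0 < n)%N ->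
  has_order (Gamma_curve A) (translation A) n <->
  one_of_cases A n /\ (forall m, (0 < m < n)%N -> ~ one_of_cases A m).
Proof.
move=> smA n0; have [Y00|Y0N0] := eqVneq (Y0 A) 0; last first.
  have E m : (0 < m)%N -> n_periodic (Gamma_curve A) (translation A) m <-> one_of_cases A m.
    by move=> m0; apply: n_periodic_cases.
  split=> [[_ per minper]|[cn minc]].
    split; first exact/E.
    by move=> m /andP[m0 mn] /(E _ m0); apply: minper; rewrite m0.
  split=> //; first exact/E.
  by move=> m /andP[m0 mn] /(E _ m0); apply: minc; rewrite m0.
have c2 m : one_of_cases A m <-> m = 2%N.
  split=> [[[//]|[k [_ _ /eqP//]]|[k [_ _ /eqP//]]]|->].
  by apply: Or31.
have per2 : n_periodic (Gamma_curve A) (translation A) 2 by exact/n_periodic2.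
have nper1 := not_n_periodic1 smA.
split=> [[_ per minper]|[/c2 -> _]].
  have n2 : n = 2%N.
    have [n2|n2|//] := ltngtP n 2.
      by case: nper1; have <- : n = 1%N by lia.
    by case: (minper 2%N).
  by rewrite n2; split=> [|m mn /c2]; [exact/c2 | lia].
by split=> // m m2; have -> : m = 1%N by lia.
Qed.

End Criterion.

(** * Rationality of the Taylor coefficients *)

Section Rationality.
Import -(notations) mpoly.
Context {R : realType}.
Implicit Types A : 'M[R[i]]_3.
Local Notation entries_poly := (mpoly.mpoly (3 * 3) rat).

Definition eval_morphism A : {rmorphism entries_poly -> R[i]} :=
  mpoly.mmap (ratr : {rmorphism rat -> R[i]}) (fun k => mxvec A 0 k).

Lemma eval_morphismE A p : eval_morphism A p = eval_entries p A.
Proof. by []. Qed.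

Definition rational_fun (F : 'M[R[i]]_3 -> R[i]) : Prop :=
  exists p : entries_poly, forall A, eval_morphism A p = F A.

Lemma rational_coef i j : rational_fun (fun A => coef A i j).
Proof.
exists (mpoly.mpolyX rat (mpoly.mnm1 (mxvec_index (inord i : 'I_3) (inord j : 'I_3)))) => A.
by rewrite [LHS]mpoly.mmapX mpoly.mmap1U mxvecE.
Qed.

Lemma rational_const (c : rat) : rational_fun (fun=> ratr c).
Proof. by exists (mpoly.mpolyC _ c) => A; rewrite [LHS]mpoly.mmapC. Qed.

Lemma rational_nat n : rational_fun (fun=> n%:R).
Proof. by have [p pE] := rational_const n%:R; exists p => A; rewrite pE ratr_nat. Qed.

Lemma rationalD F G : rational_fun F -> rational_fun G -> rational_fun (fun A => F A + G A).
Proof. by move=> [p pE] [q qE]; exists (p + q) => A; rewrite rmorphD pE qE. Qed.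

Lemma rationalM F G : rational_fun F -> rational_fun G -> rational_fun (fun A => F A * G A).
Proof. by move=> [p pE] [q qE]; exists (p * q) => A; rewrite rmorphM pE qE. Qed.

Lemma rationalN F : rational_fun F -> rational_fun (fun A => - F A).
Proof. by move=> [p pE]; exists (- p) => A; rewrite rmorphN pE. Qed.

Lemma rationalX F n : rational_fun F -> rational_fun (fun A => F A ^+ n).
Proof. by move=> [p pE]; exists (p ^+ n) => A; rewrite rmorphXn pE. Qed.

Lemma rational_invn n : rational_fun (fun=> n%:R^-1).
Proof.
by have [p pE] := rational_const n%:R^-1; exists p => A; rewrite pE fmorphV /= ratr_nat.
Qed.

Ltac rational := repeat first
  [ exact: rational_coef | apply: rational_invn | apply: rational_nat
  | apply: rationalD | apply: rationalM | apply: rationalN | apply: rationalX ].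

Lemma rational_X0 : rational_fun (@X0 _).
Proof. by rewrite /X0; rational. Qed.

Lemma rational_ext F G : (forall A, F A = G A) -> rational_fun G -> rational_fun F.
Proof. by move=> FG [p pE]; exists p => A; rewrite pE FG. Qed.

Lemma rational_Y0 : rational_fun (@Y0 _).
Proof. by apply: (rational_ext (fun A => det3E A)); rational. Qed.

Lemma rational_disc_coef i : rational_fun (fun A => disc_coef A i).
Proof.
case: i => [|[|[|[|[|i]]]]]; rewrite /disc_coef; last exact: rational_nat 0%N.
all: by rational.
Qed.

Lemma rational_D : rational_fun (@D_curve _).
Proof.
apply: (rational_ext (fun A => D_curveE A)); rewrite /D_of.
by repeat first [exact: rational_disc_coef | progress rational].
Qed.

Lemma rational_E : rational_fun (@E_curve _).
Proof.
apply: (rational_ext (fun A => E_curveE A)); rewrite /E_of.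
by repeat first [exact: rational_disc_coef | progress rational].
Qed.

(** The recursion defining sqrt_num takes place over any ring containing the
    rationals, here the polynomials in the nine entries. *)
Lemma rational_sqrt_num k : exists P : {poly entries_poly}, forall A,
  map_poly (eval_morphism A) P = sqrt_num (cubic_poly (D_curve A) (E_curve A)) k.
Proof.
have [d dE] := rational_D; have [e eE] := rational_E.
pose F := 4%:R%:P * 'X^3 - d%:P * 'X + e%:P.
have FE (phi : {rmorphism entries_poly -> R[i]}) :
    map_poly phi F = cubic_poly (phi d) (phi e).
  have e1 : map_poly phi (4%:R%:P * 'X^3) = 4%:R%:P * 'X^3.
    by rewrite rmorphM /= map_polyC map_polyXn /= rmorph_nat.
  have e2 : map_poly phi (d%:P * 'X) = (phi d)%:P * 'X.
    by rewrite rmorphM /= map_polyC map_polyX.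
  by rewrite /F /cubic_poly rmorphD rmorphB /= e1 e2 map_polyC.
clearbody F; elim: k => [|k [P PE]]; first by exists F => A; rewrite FE dE eE.
have [a aE] := rational_invn k.+1; have [b bE] := rational_invn 2.
exists (a%:P * (P^`() * F - (k%:R + b)%:P * (P * F^`()))) => A.
rewrite [RHS]/= -PE -dE -eE -FE -!mul_polyC -(aE A) -(bE A); move: (eval_morphism A) => phi.
by rewrite !rmorphM rmorphB !rmorphM /= !map_polyC !deriv_map /= rmorphD rmorph_nat.
Qed.

Lemma rational_taylor_coef k : exists num den : entries_poly,
  forall A, smooth_biquadratic A -> Y0 A != 0 ->
    eval_entries den A != 0 /\ taylor_coef A k = eval_entries num A / eval_entries den A.
Proof.
have [P PE] := rational_sqrt_num k.
have [x xE] := rational_X0; have [y yE] := rational_Y0.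
exists P.[x], (y ^+ (2 * k).+1) => A smA Y0N0.
have denE : eval_entries (y ^+ (2 * k).+1) A = Y0 A ^+ (2 * k).+1.
  by rewrite -eval_morphismE rmorphXn yE.
rewrite denE expf_neq0 //; split=> //.
have [_ P0E _] := smooth_translation_model smA.
by rewrite taylor_coefE // -PE -xE horner_map.
Qed.

End Rationality.

(** * The order of the QRT transformation *)

Theorem theorem3p3 (R : realType) :
  (forall A : 'M[R[i]]_3, smooth_biquadratic A ->
     (* (a) *)
     (forall n : nat,
        has_order (biquadratic_curve A) (QRT A) n <->
        has_order (Gamma_curve A) (translation A) n)
     /\
     (* (b), with "of order n" read as "the n-th iterate is the identity" *)
     (forall n : nat, (0 < n)%N -> ((2 < n)%N -> Y0 A != 0) ->
        (n_periodic (Gamma_curve A) (translation A) n <-> one_of_cases A n))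
     /\
     (* (b), with "of order n" read as "of exact order n" *)
     (forall n : nat, (0 < n)%N ->
        (has_order (Gamma_curve A) (translation A) n <->
         one_of_cases A n /\
         (forall m : nat, (0 < m < n)%N -> ~ one_of_cases A m))))
  /\
  (* (c) *)
  (forall k : nat, exists num den : mpoly.mpoly (3 * 3) rat,
     forall A : 'M[R[i]]_3, smooth_biquadratic A -> Y0 A != 0 ->
       eval_entries den A != 0 /\
       taylor_coef A k = eval_entries num A / eval_entries den A).
Proof.
split=> [A smA|k]; last exact: rational_taylor_coef.
split=> [n|]; first exact: has_order_QRT.
by split=> n n0; [exact: n_periodic_cases | exact: has_order_cases].
Qed.
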